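(* There exist a ring $A$, an ideal $I \subset A$ (with associated surjective ring homomorphism $A \to A/I$), and a weakly étale $A/I$-algebra $\overline{B}$ which does not lift to a weakly étale $A$-algebra; that is, there is no weakly étale $A$-algebra $B$ with $B/IB \cong \overline{B}$ as $A/I$-algebras.
   Context: All rings are commutative with unit. A ring map $R \to S$ is weakly étale (and $S$ is called a weakly étale $R$-algebra) if both $R \to S$ and the multiplication map $S \otimes_R S \to S$ are flat. *)

(* Defs.v *)
From HB Require Import structures.
From mathcomp Require Import all_boot all_order all_algebra.
From mathcomp Require Import ring_quotient generic_quotient.
From mathcomp Require Import freeg.
From mathcomp Require Import boolp.

Set Implicit Arguments.
Unset Strict Implicit.
Unset Printing Implicit Defensive.

Import GRing.Theory.
Local Open Scope ring_scope.
Local Open Scope quotient_scope.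

(* The library's [idealr] describes proper ideals of nontrivial rings, and its
   ring quotients are nontrivial.  Here rings may be zero and an ideal may be
   the whole ring (IB can be all of B), hence [comPzRingType] and the
   structures below.  Membership is boolean, which is no restriction since
   every proposition is reflected by a boolean through [boolp]. *)

HB.mixin Record isMulAbsorbing (R : comPzRingType) (S : R -> bool) := {
  mul_absorbing : forall a x : R, x \in S -> a * x \in S
}.

#[short(type="idealType")]
HB.structure Definition Ideal (R : comPzRingType) :=
  {S of GRing.ZmodClosed R S & isMulAbsorbing R S}.

Section QuotientRing.
Variables (R : comPzRingType) (I : idealType R).

Definition quot_ring : Type := Quotient.quot I.

HB.instance Definition _ := GRing.Zmodule.on quot_ring.

Definition quot_pi (x : R) : quot_ring := \pi_(Quotient.quot I) x.
Definition quot_repr (x : quot_ring) : R := repr (x : Quotient.quot I).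

Lemma quot_reprK : cancel quot_repr quot_pi.
Proof. exact: (@reprK _ (Quotient.quot I)). Qed.

Lemma quot_pi_eq x y : (quot_pi x = quot_pi y) <-> (x - y \in I).
Proof.
split=> [/eqP|xy]; first by rewrite -Quotient.idealrBE.
by apply/eqP; rewrite -Quotient.idealrBE.
Qed.

Lemma quot_pi_surj (x : quot_ring) : exists a, x = quot_pi a.
Proof. by exists (quot_repr x); rewrite quot_reprK. Qed.

Lemma quot_pi_zmod : zmod_morphism quot_pi.
Proof. exact: (@pi_is_zmod_morphism R _ _ (Quotient.quot I)). Qed.

HB.instance Definition _ :=
  GRing.isZmodMorphism.Build R quot_ring quot_pi quot_pi_zmod.

Definition quot_one : quot_ring := quot_pi 1.
Definition quot_mul (x y : quot_ring) : quot_ring :=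
  quot_pi (quot_repr x * quot_repr y).

Lemma quot_mulE a b : quot_mul (quot_pi a) (quot_pi b) = quot_pi (a * b).
Proof.
have h c : quot_repr (quot_pi c) - c \in I.
  by apply/quot_pi_eq; rewrite quot_reprK.
apply/quot_pi_eq; set a' := quot_repr _; set b' := quot_repr _.
have -> : a' * b' - a * b = a' * (b' - b) + b * (a' - a).
  by rewrite !mulrBr [b * a']mulrC [b * a]mulrC addrA subrK.
by rewrite rpredD //; apply: mul_absorbing; apply: h.
Qed.

Lemma quot_mulA : associative quot_mul.
Proof.
move=> x y z; have [a ->] := quot_pi_surj x; have [b ->] := quot_pi_surj y.
by have [c ->] := quot_pi_surj z; rewrite !quot_mulE mulrA.
Qed.

Lemma quot_mulC : commutative quot_mul.
Proof.
move=> x y; have [a ->] := quot_pi_surj x; have [b ->] := quot_pi_surj y.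
by rewrite !quot_mulE mulrC.
Qed.

Lemma quot_mul1 : left_id quot_one quot_mul.
Proof. by move=> x; have [a ->] := quot_pi_surj x; rewrite quot_mulE mul1r. Qed.

Lemma quot_mulDl : left_distributive quot_mul +%R.
Proof.
move=> x y z; have [a ->] := quot_pi_surj x; have [b ->] := quot_pi_surj y.
have [c ->] := quot_pi_surj z.
by rewrite -raddfD !quot_mulE -raddfD mulrDl.
Qed.

HB.instance Definition _ := GRing.Zmodule_isComPzRing.Build quot_ring
  quot_mulA quot_mulC quot_mul1 quot_mulDl.

Lemma quot_pi_monoid : monoid_morphism quot_pi.
Proof. by split=> // x y; rewrite -quot_mulE. Qed.

HB.instance Definition _ :=
  GRing.isMonoidMorphism.Build R quot_ring quot_pi quot_pi_monoid.

End QuotientRing.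

Section IdealExtension.
Variables (A B : comPzRingType) (f : {rmorphism A -> B}) (I : idealType A).

Definition ext_ideal_pred (b : B) : bool :=
  `[< exists s : seq (B * A),
        all (fun p => p.2 \in I) s /\ b = \sum_(p <- s) p.1 * f p.2 >].

Lemma ext_ideal_zmod : zmod_closed ext_ideal_pred.
Proof.
split; first by apply/asboolP; exists [::]; rewrite big_nil.
move=> x y /asboolP[s [sI ->]] /asboolP[t [tI ->]]; apply/asboolP.
exists (s ++ [seq (- p.1, p.2) | p <- t]); split.
  by rewrite all_cat sI all_map.
rewrite big_cat big_map /= -sumrN; congr (_ + _).
by apply: eq_bigr => p _; rewrite mulNr.
Qed.

Lemma ext_ideal_mul (a x : B) : x \in ext_ideal_pred -> a * x \in ext_ideal_pred.
Proof.
move=> /asboolP[s [sI ->]]; apply/asboolP.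
exists [seq (a * p.1, p.2) | p <- s]; split; first by rewrite all_map.
by rewrite big_map mulr_sumr; apply: eq_bigr => p _; rewrite mulrA.
Qed.

HB.instance Definition _ := GRing.isZmodClosed.Build B ext_ideal_pred ext_ideal_zmod.
HB.instance Definition _ := isMulAbsorbing.Build B ext_ideal_pred ext_ideal_mul.

Definition ext_ideal : idealType B := Ideal.clone B ext_ideal_pred _.

Lemma ext_ideal_mem a : a \in I -> f a \in ext_ideal.
Proof.
move=> aI; apply/asboolP; exists [:: (1, a)].
by rewrite /= aI big_seq1 mul1r.
Qed.

Definition quot_map (x : quot_ring I) : quot_ring ext_ideal :=
  quot_pi ext_ideal (f (quot_repr x)).

Lemma quot_mapE a : quot_map (quot_pi I a) = quot_pi ext_ideal (f a).
Proof.
apply/quot_pi_eq; rewrite -rmorphB; apply: ext_ideal_mem.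
by apply/quot_pi_eq; rewrite quot_reprK.
Qed.

Lemma quot_map_zmod : zmod_morphism quot_map.
Proof.
move=> x y; have [a ->] := quot_pi_surj x; have [b ->] := quot_pi_surj y.
by rewrite -raddfB !quot_mapE !rmorphB.
Qed.

Lemma quot_map_monoid : monoid_morphism quot_map.
Proof.
split=> [|x y]; first by rewrite -(rmorph1 (quot_pi I)) quot_mapE !rmorph1.
have [a ->] := quot_pi_surj x; have [b ->] := quot_pi_surj y.
by rewrite -rmorphM !quot_mapE !rmorphM.
Qed.

HB.instance Definition _ := GRing.isZmodMorphism.Build
  (quot_ring I) (quot_ring ext_ideal) quot_map quot_map_zmod.
HB.instance Definition _ := GRing.isMonoidMorphism.Build
  (quot_ring I) (quot_ring ext_ideal) quot_map quot_map_monoid.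

End IdealExtension.

Arguments quot_map {A B} f I _.

(* An R-algebra is given by its structure map R -> S. *)
Definition alg_iso (R S T : comPzRingType)
    (g : {rmorphism R -> S}) (h : {rmorphism R -> T}) : Prop :=
  exists phi : {rmorphism S -> T}, bijective phi /\ forall r, phi (g r) = h r.

Section GeneratedSubgroup.
Variables (V : zmodType) (S : V -> Prop).

Definition gen_subgroup_pred (v : V) : bool :=
  `[< forall P : V -> Prop, P 0 -> (forall x y, P x -> P y -> P (x - y)) ->
        (forall s, S s -> P s) -> P v >].

Lemma gen_subgroup_zmod : zmod_closed gen_subgroup_pred.
Proof.
split; first by apply/asboolP.
move=> x y /asboolP Px /asboolP Py; apply/asboolP => P P0 PB PS.
by apply: (PB); [apply: Px | apply: Py].
Qed.

HB.instance Definition _ :=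
  GRing.isZmodClosed.Build V gen_subgroup_pred gen_subgroup_zmod.

Definition gen_subgroup : zmodClosed V :=
  GRing.ZmodClosed.clone V gen_subgroup_pred _.

Lemma gen_subgroup_mem s : S s -> s \in gen_subgroup.
Proof. by move=> Ss; apply/asboolP => P _ _; apply. Qed.

Lemma gen_subgroup_ind (P : V -> Prop) :
  P 0 -> (forall x y, P x -> P y -> P (x - y)) -> (forall s, S s -> P s) ->
  forall v, v \in gen_subgroup -> P v.
Proof. by move=> P0 PB PS v /asboolP; apply. Qed.

End GeneratedSubgroup.

Section FreeAbelian.
Variables (K : choiceType) (V : zmodType) (f : K -> V).

(* [ssrint.zmodule V] is V seen as a Z-module. *)
Definition free_lift (D : {freeg K / int}) : V :=
  fglift (f : K -> ssrint.zmodule V) D.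

Lemma free_lift_zmod : zmod_morphism free_lift.
Proof. exact: (@lift_is_additive int K (ssrint.zmodule V) f). Qed.

HB.instance Definition _ :=
  GRing.isZmodMorphism.Build {freeg K / int} V free_lift free_lift_zmod.

Lemma free_liftU k : free_lift << k >> = f k.
Proof. by rewrite /free_lift liftU scale1r. Qed.

End FreeAbelian.

Lemma freeg_ind (K : choiceType) (P : {freeg K / int} -> Prop) :
  P 0 -> (forall x y, P x -> P y -> P (x - y)) ->
  (forall k, P << k >>) -> forall D, P D.
Proof.
move=> P0 PB PU D.
have PN x : P x -> P (- x) by move=> Px; rewrite -sub0r; apply: PB.
have PD x y : P x -> P y -> P (x + y).
  by move=> Px Py; rewrite -[y]opprK; apply: PB => //; apply: PN.
have -> : D = \sum_(k <- dom D) << coeff k D *g k >> by rewrite freeg_sumE.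
elim: (dom D) => [|k s IH]; first by rewrite big_nil.
rewrite big_cons; apply: (PD _ _ _ IH); move: (coeff k D).
have PUn (n : nat) : P << n%:Z *g k >>.
  elim: n => [|n IHn]; first by rewrite freegU0.
  by rewrite -addn1 PoszD -freegUD; apply: PD.
by case=> [//|n]; rewrite NegzE -freegUN; apply: PN; apply: PUn.
Qed.

Section Tensor.
Variables (R : comPzRingType) (M N : lmodType R).

Local Notation free := {freeg (M * N)%type / int}.

Inductive tensor_rel : free -> Prop :=
  | TensorDl m m' n : tensor_rel
      (<< (m + m', n) >> - (<< (m, n) >> + << (m', n) >>))
  | TensorDr m n n' : tensor_rel
      (<< (m, n + n') >> - (<< (m, n) >> + << (m, n') >>))
  | TensorZ a m n : tensor_rel
      (<< (a *: m, n) >> - << (m, a *: n) >>).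

Definition tensor : Type := Quotient.quot (gen_subgroup tensor_rel).

HB.instance Definition _ := GRing.Zmodule.on tensor.

Definition tensor_pi (D : free) : tensor :=
  \pi_(Quotient.quot (gen_subgroup tensor_rel)) D.

Lemma tensor_pi_zmod : zmod_morphism tensor_pi.
Proof. exact: (@pi_is_zmod_morphism _ _ _ (Quotient.quot _)). Qed.

HB.instance Definition _ :=
  GRing.isZmodMorphism.Build free tensor tensor_pi tensor_pi_zmod.

Definition tensor_repr (t : tensor) : free :=
  repr (t : Quotient.quot (gen_subgroup tensor_rel)).

Lemma tensor_reprK : cancel tensor_repr tensor_pi.
Proof. exact: (@reprK _ (Quotient.quot _)). Qed.

Lemma tensor_pi_eq x y :
  (tensor_pi x = tensor_pi y) <-> (x - y \in gen_subgroup tensor_rel).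
Proof.
split=> [/eqP|xy]; first by rewrite -Quotient.idealrBE.
by apply/eqP; rewrite -Quotient.idealrBE.
Qed.

Definition pure (m : M) (n : N) : tensor := tensor_pi << (m, n) >>.

Lemma pureDl m m' n : pure (m + m') n = pure m n + pure m' n.
Proof.
rewrite -raddfD; apply/tensor_pi_eq/gen_subgroup_mem; exact: TensorDl.
Qed.

Lemma pureDr m n n' : pure m (n + n') = pure m n + pure m n'.
Proof.
rewrite -raddfD; apply/tensor_pi_eq/gen_subgroup_mem; exact: TensorDr.
Qed.

Lemma pureZ a m n : pure (a *: m) n = pure m (a *: n).
Proof. apply/tensor_pi_eq/gen_subgroup_mem; exact: TensorZ. Qed.

Lemma tensor_ind (P : tensor -> Prop) :
  P 0 -> (forall x y, P x -> P y -> P (x - y)) ->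
  (forall m n, P (pure m n)) -> forall t, P t.
Proof.
move=> P0 PB Pp t; rewrite -(tensor_reprK t).
apply: (@freeg_ind _ (fun D => P (tensor_pi D))) => [|x y|[m n]].
- by rewrite raddf0.
- by rewrite raddfB; apply: PB.
- exact: Pp.
Qed.

Section Lift.
Variables (V : zmodType) (f : M -> N -> V).

(* The additive map m (x) n |-> f m n; meaningful when f is balanced. *)
Definition tensor_lift (t : tensor) : V :=
  free_lift (fun p => f p.1 p.2) (tensor_repr t).

Definition balanced : Prop :=
  [/\ forall m m' n, f (m + m') n = f m n + f m' n,
      forall m n n', f m (n + n') = f m n + f m n' &
      forall a m n, f (a *: m) n = f m (a *: n)].

Hypothesis fB : balanced.

Lemma tensor_lift_pi D :
  tensor_lift (tensor_pi D) = free_lift (fun p => f p.1 p.2) D.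
Proof.
have [fDl fDr fZ] := fB.
set F := fun p => _; apply/eqP; rewrite -subr_eq0 -[tensor_lift _]/(free_lift F _).
rewrite -raddfB /=; apply/eqP.
have : tensor_repr (tensor_pi D) - D \in gen_subgroup tensor_rel.
  by apply/tensor_pi_eq; rewrite tensor_reprK.
apply: (gen_subgroup_ind (P := fun v => free_lift F v = 0)) => [|x y x0 y0|_ [m m' n|m n n'|a m n]].
- by rewrite raddf0.
- by rewrite raddfB /= x0 y0 subrr.
- by rewrite raddfB raddfD /= !free_liftU /F /= fDl subrr.
- by rewrite raddfB raddfD /= !free_liftU /F /= fDr subrr.
- by rewrite raddfB /= !free_liftU /F /= fZ subrr.
Qed.

Lemma tensor_lift_pure m n : tensor_lift (pure m n) = f m n.
Proof. by rewrite tensor_lift_pi free_liftU. Qed.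

Lemma tensor_liftB : zmod_morphism tensor_lift.
Proof.
move=> x y; rewrite -(tensor_reprK x) -(tensor_reprK y) -raddfB.
by rewrite !tensor_lift_pi raddfB.
Qed.

Lemma tensor_lift0 : tensor_lift 0 = 0.
Proof. by have := tensor_liftB 0 0; rewrite !subrr. Qed.

Lemma tensor_liftD : {morph tensor_lift : x y / x + y}.
Proof.
move=> x y; rewrite -{1}[y]opprK tensor_liftB -[- y]sub0r tensor_liftB.
by rewrite tensor_lift0 sub0r opprK.
Qed.

End Lift.

Definition tensor_scale (a : R) : tensor -> tensor :=
  tensor_lift (fun m n => pure (a *: m) n).

Lemma tensor_scale_balanced a : balanced (fun m n => pure (a *: m) n).
Proof.
split=> *; rewrite ?scalerDr ?pureDl ?pureDr //.
by rewrite scalerA mulrC -scalerA pureZ.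
Qed.

Lemma tensor_scale_pure a m n : tensor_scale a (pure m n) = pure (a *: m) n.
Proof. exact/tensor_lift_pure/tensor_scale_balanced. Qed.

Lemma tensor_scaleB a : zmod_morphism (tensor_scale a).
Proof. exact/tensor_liftB/tensor_scale_balanced. Qed.

Lemma tensor_scale0 a : tensor_scale a 0 = 0.
Proof. exact/tensor_lift0/tensor_scale_balanced. Qed.

Lemma tensor_scaleA a b t :
  tensor_scale a (tensor_scale b t) = tensor_scale (a * b) t.
Proof.
elim/tensor_ind: t => [|x y Hx Hy|m n]; first by rewrite !tensor_scale0.
  by rewrite !tensor_scaleB Hx Hy.
by rewrite !tensor_scale_pure scalerA.
Qed.

Lemma tensor_scale1 : left_id 1 tensor_scale.
Proof.
elim/tensor_ind => [|x y Hx Hy|m n]; first by rewrite tensor_scale0.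
  by rewrite tensor_scaleB Hx Hy.
by rewrite tensor_scale_pure scale1r.
Qed.

Lemma tensor_scaleDr : right_distributive tensor_scale +%R.
Proof. by move=> a; apply/tensor_liftD/tensor_scale_balanced. Qed.

Lemma tensor_scaleDl t : {morph tensor_scale^~ t : a b / a + b}.
Proof.
move=> a b; elim/tensor_ind: t => [|x y Hx Hy|m n].
- by rewrite !tensor_scale0 addr0.
- by rewrite !tensor_scaleB Hx Hy opprD addrACA.
- by rewrite !tensor_scale_pure scalerDl pureDl.
Qed.

HB.instance Definition _ := GRing.Zmodule_isLmodule.Build R tensor
  tensor_scaleA tensor_scale1 tensor_scaleDr tensor_scaleDl.

End Tensor.

Definition tensor_map (R : comPzRingType) (M M' N : lmodType R)
    (u : {linear M -> M'}) : tensor M N -> tensor M' N :=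
  tensor_lift (fun m n => pure (u m) n).

Arguments tensor_map {R M M'} N u _.

Definition flat (R : comPzRingType) (N : lmodType R) : Prop :=
  forall (M M' : lmodType R) (u : {linear M -> M'}),
    injective u -> injective (tensor_map N u).

(* S regarded as an R-module through f. *)
Definition restrict (R S : comPzRingType) (f : {rmorphism R -> S}) : Type := S.

Section Restrict.
Variables (R S : comPzRingType) (f : {rmorphism R -> S}).

HB.instance Definition _ := GRing.ComPzRing.copy (restrict f) S.

Definition restrict_scale (a : R) (x : restrict f) : restrict f := f a * x.

Lemma restrict_scaleA a b x :
  restrict_scale a (restrict_scale b x) = restrict_scale (a * b) x.
Proof. by rewrite /restrict_scale rmorphM mulrA. Qed.

Lemma restrict_scale1 : left_id 1 restrict_scale.
Proof. by move=> x; rewrite /restrict_scale rmorph1 mul1r. Qed.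

Lemma restrict_scaleDr : right_distributive restrict_scale +%R.
Proof. by move=> a x y; rewrite /restrict_scale mulrDr. Qed.

Lemma restrict_scaleDl x : {morph restrict_scale^~ x : a b / a + b}.
Proof. by move=> a b; rewrite /restrict_scale rmorphD mulrDl. Qed.

HB.instance Definition _ := GRing.Zmodule_isLmodule.Build R (restrict f)
  restrict_scaleA restrict_scale1 restrict_scaleDr restrict_scaleDl.

Lemma restrict_scaleE (a : R) (x : restrict f) : a *: x = f a * x.
Proof. by []. Qed.

Lemma restrict_scaleAl (a : R) (x y : restrict f) : a *: (x * y) = (a *: x) * y.
Proof. exact: mulrA. Qed.

Lemma restrict_scaleAr (a : R) (x y : restrict f) : a *: (x * y) = x * (a *: y).
Proof. exact: mulrCA. Qed.

End Restrict.

Definition flat_map (R S : comPzRingType) (f : {rmorphism R -> S}) : Prop :=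
  flat (restrict f).

Section TensorAlgebra.
Variables (R S T : comPzRingType).
Variables (f : {rmorphism R -> S}) (g : {rmorphism R -> T}).

Definition tensor_alg : Type := tensor (restrict f) (restrict g).

HB.instance Definition _ := GRing.Zmodule.on tensor_alg.

Local Notation "s ** t" := (@pure R (restrict f) (restrict g) s t : tensor_alg)
  (at level 40).

Definition tensor_mulp (s : restrict f) (t : restrict g) :
    tensor_alg -> tensor_alg :=
  tensor_lift (fun s' t' => (s * s') ** (t * t')).

Definition tensor_mul (x y : tensor_alg) : tensor_alg :=
  tensor_lift (fun s t => tensor_mulp s t y) x.

Definition tensor_one : tensor_alg := 1 ** 1.

Lemma tensor_mulp_balanced s t :
  balanced (fun (s' : restrict f) (t' : restrict g) => (s * s') ** (t * t')).
Proof.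
split=> [m m' n|m n n'|a m n].
- by rewrite mulrDr pureDl.
- by rewrite mulrDr pureDr.
- by rewrite -!restrict_scaleAr pureZ.
Qed.

Lemma tensor_mulpE s t s' t' :
  tensor_mulp s t (s' ** t') = (s * s') ** (t * t').
Proof. exact/tensor_lift_pure/tensor_mulp_balanced. Qed.

Lemma tensor_mulpB s t : zmod_morphism (tensor_mulp s t).
Proof. exact/tensor_liftB/tensor_mulp_balanced. Qed.

Lemma tensor_mulp0 s t : tensor_mulp s t 0 = 0.
Proof. exact/tensor_lift0/tensor_mulp_balanced. Qed.

Lemma tensor_mul_balanced y :
  balanced (fun (s : restrict f) (t : restrict g) => tensor_mulp s t y).
Proof.
split=> [m m' n|m n n'|a m n]; elim/tensor_ind: y => [|x y Hx Hy|s t].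
- by rewrite !tensor_mulp0 addr0.
- by rewrite !tensor_mulpB Hx Hy opprD addrACA.
- by rewrite !tensor_mulpE mulrDl pureDl.
- by rewrite !tensor_mulp0 addr0.
- by rewrite !tensor_mulpB Hx Hy opprD addrACA.
- by rewrite !tensor_mulpE mulrDl pureDr.
- by rewrite !tensor_mulp0.
- by rewrite !tensor_mulpB Hx Hy.
- by rewrite !tensor_mulpE -!restrict_scaleAl pureZ.
Qed.

Lemma tensor_mul_purel s t y : tensor_mul (s ** t) y = tensor_mulp s t y.
Proof. exact: (tensor_lift_pure (tensor_mul_balanced y)). Qed.

Lemma tensor_mul_pure s t s' t' :
  tensor_mul (s ** t) (s' ** t') = (s * s') ** (t * t').
Proof. by rewrite tensor_mul_purel tensor_mulpE. Qed.

Lemma tensor_mulBl x x' y :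
  tensor_mul (x - x') y = tensor_mul x y - tensor_mul x' y.
Proof. exact/tensor_liftB/tensor_mul_balanced. Qed.

Lemma tensor_mul0l y : tensor_mul 0 y = 0.
Proof. exact/tensor_lift0/tensor_mul_balanced. Qed.

Lemma tensor_mul0r x : tensor_mul x 0 = 0.
Proof.
elim/tensor_ind: x => [|x y Hx Hy|s t]; first exact: tensor_mul0l.
  by rewrite tensor_mulBl Hx Hy subrr.
by rewrite tensor_mul_purel tensor_mulp0.
Qed.

Lemma tensor_mulBr x y y' :
  tensor_mul x (y - y') = tensor_mul x y - tensor_mul x y'.
Proof.
elim/tensor_ind: x => [|x x' Hx Hx'|s t]; first by rewrite !tensor_mul0l subrr.
  by rewrite !tensor_mulBl Hx Hx' !opprD addrACA.
by rewrite !tensor_mul_purel tensor_mulpB.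
Qed.

Lemma tensor_mulC : commutative tensor_mul.
Proof.
move=> x y; elim/tensor_ind: x => [|x x' Hx Hx'|s t].
- by rewrite tensor_mul0l tensor_mul0r.
- by rewrite tensor_mulBl tensor_mulBr Hx Hx'.
elim/tensor_ind: y => [|y y' Hy Hy'|s' t'].
- by rewrite tensor_mul0l tensor_mul0r.
- by rewrite tensor_mulBl tensor_mulBr Hy Hy'.
- by rewrite !tensor_mul_pure (mulrC s) (mulrC t).
Qed.

Lemma tensor_mulA : associative tensor_mul.
Proof.
move=> x y z; elim/tensor_ind: x => [|x x' Hx Hx'|s t].
- by rewrite !tensor_mul0l.
- by rewrite !tensor_mulBl Hx Hx'.
elim/tensor_ind: y => [|y y' Hy Hy'|s' t'].
- by rewrite tensor_mul0l !tensor_mul0r tensor_mul0l.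
- by rewrite !tensor_mulBl !tensor_mulBr tensor_mulBl Hy Hy'.
elim/tensor_ind: z => [|z z' Hz Hz'|s'' t''].
- by rewrite !tensor_mul0r.
- by rewrite !tensor_mulBr Hz Hz'.
- by rewrite !tensor_mul_pure !mulrA.
Qed.

Lemma tensor_mul1 : left_id tensor_one tensor_mul.
Proof.
elim/tensor_ind => [|x y Hx Hy|s t]; first exact: tensor_mul0r.
  by rewrite tensor_mulBr Hx Hy.
by rewrite tensor_mul_pure !mul1r.
Qed.

Lemma tensor_mulDl : left_distributive tensor_mul +%R.
Proof. by move=> x y z; apply: tensor_liftD; apply: tensor_mul_balanced. Qed.

HB.instance Definition _ := GRing.Zmodule_isComPzRing.Build tensor_alg
  tensor_mulA tensor_mulC tensor_mul1 tensor_mulDl.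

End TensorAlgebra.

Section Multiplication.
Variables (R S : comPzRingType) (f : {rmorphism R -> S}).

Definition mult_map : tensor_alg f f -> S :=
  @tensor_lift R (restrict f) (restrict f) S (fun x y => (x : S) * (y : S)).

Lemma mult_balanced :
  @balanced R (restrict f) (restrict f) S (fun x y => (x : S) * (y : S)).
Proof.
split=> [m m' n|m n n'|a m n]; [exact: mulrDl | exact: mulrDr |].
by rewrite !restrict_scaleE mulrCA mulrA.
Qed.

Lemma mult_map_pure (x y : S) : mult_map (@pure R (restrict f) (restrict f) x y) = x * y.
Proof. exact/tensor_lift_pure/mult_balanced. Qed.

Lemma mult_map_zmod : zmod_morphism mult_map.
Proof. exact/tensor_liftB/mult_balanced. Qed.

HB.instance Definition _ :=
  GRing.isZmodMorphism.Build (tensor_alg f f) S mult_map mult_map_zmod.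

Lemma mult_map_monoid : monoid_morphism mult_map.
Proof.
split=> [|x y]; first by rewrite mult_map_pure mulr1.
elim/tensor_ind: x => [|x x' Hx Hx'|s t].
- by rewrite mul0r raddf0 mul0r.
- by rewrite mulrBl !raddfB /= Hx Hx' mulrBl.
elim/tensor_ind: y => [|y y' Hy Hy'|s' t'].
- by rewrite mulr0 raddf0 mulr0.
- by rewrite mulrBr !raddfB /= Hy Hy' mulrBr.
- by rewrite [_ * _]tensor_mul_pure !mult_map_pure mulrACA.
Qed.

HB.instance Definition _ :=
  GRing.isMonoidMorphism.Build (tensor_alg f f) S mult_map mult_map_monoid.

End Multiplication.

Arguments mult_map {R S} f _.

Definition weakly_etale (R S : comPzRingType) (f : {rmorphism R -> S}) : Prop :=
  flat_map f /\ flat_map (mult_map f).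

(* Main.v *)
(** Over [A = Z[X]] let [I] be the ideal of polynomials vanishing at [0] and [6],
so that [A/I] is the ring of pairs [(a, b)] with [a = b] mod [6]: two copies of
[Spec Z], the lines [X = 0] and [X = 6], glued at the primes [2] and [3].  Since
these two nodes form a loop, [Spec (A/I)] has an infinite covering by a chain of
lines indexed by the integers.  Adding a limit point [oo] fixed by the shift
gives a weakly étale algebra [Bbar]: after inverting [2] or [3] it is the
algebra of locally constant functions on [Z + {oo}].

Let [B] be a weakly étale lift, [b] in [B], and [c = b (x) 1 - 1 (x) b].
Flatness of the multiplication map gives [u] with [u c = 0] and [u = 1] on the
diagonal.  So [u = 1] at the points [(s, oo)] of [B (x) B] for all large [s],
and [c] vanishes to infinite order along the lines [(s, oo)].  As [A] is normal,
hence unibranch, vanishing to infinite order spreads through the nodes from one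
line to the next, and reaches every [(s, oo)].  Hence [b] takes the same value
at [s] and [oo] for all [s], which is absurd as [B] surjects onto [Bbar]. *)

From HB Require Import structures.
From mathcomp Require Import all_boot all_order all_algebra.
From mathcomp Require Import ring_quotient generic_quotient boolp functions.
From mathcomp Require Import zify ring.
Require Import Defs.

Set Implicit Arguments.
Unset Strict Implicit.
Unset Printing Implicit Defensive.

Import GRing.Theory Num.Theory.
Local Open Scope ring_scope.
Local Open Scope quotient_scope.

(** * Flatness and pure kernels *)

Section Pure.
Variables (R : comPzRingType) (M N : lmodType R).

Lemma pure0l (n : N) : pure (0 : M) n = 0.
Proof. by apply: (addIr (pure 0 n)); rewrite -pureDl !add0r. Qed.

Lemma pure0r (m : M) : pure m (0 : N) = 0.
Proof. by apply: (addIr (pure m 0)); rewrite -pureDr !add0r. Qed.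

Lemma pureBl (m m' : M) (n : N) : pure (m - m') n = pure m n - pure m' n.
Proof. by apply: (addIr (pure m' n)); rewrite -pureDl !subrK. Qed.

End Pure.

Section TensorMap.
Variables (R : comPzRingType) (N : lmodType R).

Section Morphism.
Variables (M M' : lmodType R) (u : {linear M -> M'}).

Lemma tensor_map_balanced : balanced (fun m (n : N) => pure (u m) n).
Proof.
split=> [m m' n|m n n'|a m n].
- by rewrite raddfD pureDl.
- by rewrite pureDr.
- by rewrite linearZ pureZ.
Qed.

Lemma tensor_map_pure m n : tensor_map N u (pure m n) = pure (u m) n.
Proof. exact/tensor_lift_pure/tensor_map_balanced. Qed.

Lemma tensor_mapB : zmod_morphism (tensor_map N u).
Proof. exact/tensor_liftB/tensor_map_balanced. Qed.

Lemma tensor_map0 : tensor_map N u 0 = 0.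
Proof. exact/tensor_lift0/tensor_map_balanced. Qed.

End Morphism.

Lemma flat_ker :
  (forall (M M' : lmodType R) (u : {linear M -> M'}), injective u ->
     forall t, tensor_map N u t = 0 -> t = 0) -> flat N.
Proof.
move=> ker0 M M' u u_inj t t' tt'; apply/eqP; rewrite -subr_eq0; apply/eqP.
by apply: (ker0 _ _ u u_inj); rewrite tensor_mapB tt' subrr.
Qed.

(** Scaling by [a] on [M (x) N] is the base change of the linear map scaling by [a] on [M]. *)
Lemma flat_scale_inj (M : lmodType R) (a : R) : flat N ->
  injective (fun m : M => a *: m) -> injective (fun t : tensor M N => a *: t).
Proof.
move=> Nflat a_inj; have mapE : tensor_map N ( *:%R a) =1 (fun t : tensor M N => a *: t).
  elim/tensor_ind => [|x y Hx Hy|m n].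
  - by rewrite tensor_map0 scaler0.
  - by rewrite tensor_mapB Hx Hy scalerBr.
  - by rewrite tensor_map_pure -tensor_scale_pure.
by move=> x y; rewrite -!mapE; apply: Nflat.
Qed.

Definition regular_module : lmodType R := restrict (@idfun R : {rmorphism R -> R}).

Lemma pure1_inj : injective (fun n : N => pure (1 : regular_module) n).
Proof.
have Bal : balanced (fun (r : regular_module) (n : N) => (r : R) *: n).
  split=> [m m' n|m n n'|a m n]; [exact: scalerDl | exact: scalerDr |].
  by rewrite restrict_scaleE mulrC scalerA.
move=> n n' /(congr1 (tensor_lift (fun (r : regular_module) (n : N) => (r : R) *: n))).
by rewrite !tensor_lift_pure // !scale1r.
Qed.

Lemma flat_regular (a : R) : flat N ->
  injective ( *%R a) -> injective (fun n : N => a *: n).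
Proof.
move=> Nflat a_inj n n' /(congr1 (pure (1 : regular_module))); rewrite -!pureZ.
have aE x : pure (a *: (1 : regular_module)) x = a *: pure (1 : regular_module) x.
  by rewrite -tensor_scale_pure.
by rewrite !aE => /(flat_scale_inj (M := regular_module) Nflat a_inj)/pure1_inj.
Qed.

End TensorMap.

Section Annihilator.
Variables (R : comPzRingType) (c : R).

Definition annihilator_pred (z : R) : bool := z * c == 0.

Lemma annihilator_zmod : zmod_closed annihilator_pred.
Proof.
split; rewrite ?unfold_in /annihilator_pred ?mul0r // => x y.
by rewrite !unfold_in mulrBl => /eqP -> /eqP ->; rewrite subrr.
Qed.

Lemma annihilator_mul (a x : R) : x \in annihilator_pred -> a * x \in annihilator_pred.
Proof. by rewrite !unfold_in -mulrA => /eqP ->; rewrite mulr0. Qed.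

HB.instance Definition _ := GRing.isZmodClosed.Build R annihilator_pred annihilator_zmod.
HB.instance Definition _ := isMulAbsorbing.Build R annihilator_pred annihilator_mul.

Definition annihilator : idealType R := Ideal.clone R annihilator_pred _.

(** Induced by multiplication by [c]: an injection of [R / Ann(c)] into [R], on which flatness gets
    tested. *)
Definition annihilator_scale (x : restrict (quot_pi annihilator)) : regular_module R :=
  (quot_repr x : R) * c.

Lemma annihilator_scale_pi a : annihilator_scale (quot_pi annihilator a) = a * c.
Proof.
apply/eqP; rewrite -subr_eq0 -mulrBl -[_ == 0]/(_ - a \in annihilator).
by apply/quot_pi_eq; rewrite quot_reprK.
Qed.

Lemma annihilator_scale_linear : linear annihilator_scale.
Proof.
move=> a x y; have [b ->] := quot_pi_surj x; have [d ->] := quot_pi_surj y.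
rewrite !restrict_scaleE.
have -> : quot_pi annihilator a * quot_pi annihilator b + quot_pi annihilator d
   = quot_pi annihilator (a * b + d) by rewrite rmorphD rmorphM.
by rewrite !annihilator_scale_pi mulrDl mulrA.
Qed.

HB.instance Definition _ := GRing.isLinear.Build R (restrict (quot_pi annihilator))
  (regular_module R) _ annihilator_scale annihilator_scale_linear.

Lemma annihilator_scale_inj : injective annihilator_scale.
Proof.
move=> x y; have [b ->] := quot_pi_surj x; have [d ->] := quot_pi_surj y.
rewrite !annihilator_scale_pi => bd; apply/quot_pi_eq.
by rewrite unfold_in /annihilator_pred mulrBl bd subrr.
Qed.

End Annihilator.

Section PureKernel.
Variables (C B : comPzRingType) (p : {rmorphism C -> B}).
Hypothesis p_surj : forall b, exists c, p c = b.

(** The kernel of localizing [M] at the elements over 1. If [p] has a pure kernel, the quotient of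
    [M] by it is a model of [M (x) B]. *)
Definition killed_in (M : lmodType C) (m : M) : bool :=
  `[< exists w, p w = 1 /\ w *: m = 0 >].

Lemma killed_zmod (M : lmodType C) : zmod_closed (@killed_in M).
Proof.
split; first by apply/asboolP; exists 1; rewrite rmorph1 scaler0.
move=> x y /asboolP[w [w1 wx]] /asboolP[w' [w'1 w'y]]; apply/asboolP.
exists (w * w'); rewrite rmorphM w1 w'1 mulr1; split=> //.
by rewrite scalerBr -[in X in _ - X]scalerA w'y mulrC -scalerA wx !scaler0 subrr.
Qed.

HB.instance Definition _ (M : lmodType C) :=
  GRing.isZmodClosed.Build M (@killed_in M) (@killed_zmod M).

(** As [p] is onto, every tensor is some [m (x) 1]. If it dies under [u], some [w] over 1 kills
    [u m], hence [m], and [m (x) 1 = w m (x) 1 = 0]. *)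
Lemma flat_of_pure_ker :
  (forall c, p c = 0 -> exists w, p w = 1 /\ w * c = 0) -> flat_map p.
Proof.
move=> pure_ker; pose lft b := projT1 (cid (p_surj b)).
have lftK b : p (lft b) = b by rewrite /lft; case: cid.
apply: flat_ker => M M' u u_inj t.
have [m ->] : exists m, t = pure m (1 : restrict p).
  elim/tensor_ind: t => [|x y [m ->] [m' ->]|m b].
  - by exists 0; rewrite pure0l.
  - by exists (m - m'); rewrite pureBl.
  - by exists (lft b *: m); rewrite pureZ restrict_scaleE mulr1 lftK.
rewrite tensor_map_pure.
pose K : zmodClosed M' := GRing.ZmodClosed.clone _ (@killed_in M') _.
pose pi (x : M') : Quotient.quot K := \pi_(Quotient.quot K) x.
have piB : zmod_morphism pi := @pi_is_zmod_morphism _ _ _ (Quotient.quot K).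
have piE x y : x - y \in K -> pi x = pi y.
  by move=> xy; apply/eqP; rewrite -Quotient.idealrBE.
have pi0 : pi 0 = 0 by have := piB 0 0; rewrite !subrr.
have piD x y : pi (x + y) = pi x + pi y.
  by rewrite -[y in LHS]opprK piB -[- y]sub0r piB pi0 sub0r opprK.
(* Two lifts of [b] differ by an element of the kernel of [p], whose multiples lie in [K] by purity;
   hence [F] is balanced. *)
pose F (x : M') (b : restrict p) := pi (lft b *: x).
have kerK c (x : M') : p c = 0 -> c *: x \in K.
  move=> /pure_ker[w [w1 wc]]; apply/asboolP; exists w.
  by rewrite scalerA wc scale0r.
have FB : balanced F.
  split=> [x y b|x b d|a x b]; rewrite /F.
  - by rewrite scalerDr piD.
  - rewrite -piD; apply: piE; rewrite -scalerDl -scalerBl; apply: kerK.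
    by rewrite rmorphB rmorphD !lftK subrr.
  - apply: piE; rewrite scalerA -scalerBl; apply: kerK.
    by rewrite rmorphB rmorphM !lftK restrict_scaleE mulrC subrr.
move=> /(congr1 (tensor_lift F)); rewrite tensor_lift_pure // tensor_lift0 //.
rewrite -pi0 => /eqP; rewrite -Quotient.idealrBE subr0 => /asboolP[w [w1]].
rewrite scalerA -linearZ -[0](raddf0 u) => /u_inj wm.
have -> : pure m (1 : restrict p) = pure m ((w * lft 1) *: (1 : restrict p)).
  by rewrite restrict_scaleE rmorphM w1 lftK !mulr1.
by rewrite -pureZ wm pure0l.
Qed.

Section Image.
Variable I : idealType C.

Definition image_ideal_pred (b : B) : bool := `[< exists2 z, z \in I & b = p z >].

Lemma image_ideal_zmod : zmod_closed image_ideal_pred.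
Proof.
split; first by apply/asboolP; exists 0; rewrite ?rpred0 ?rmorph0.
move=> _ _ /asboolP[x xI ->] /asboolP[y yI ->]; apply/asboolP.
by exists (x - y); rewrite ?rpredB ?rmorphB.
Qed.

Lemma image_ideal_mul (a x : B) : x \in image_ideal_pred -> a * x \in image_ideal_pred.
Proof.
move=> /asboolP[z zI ->]; have [d <-] := p_surj a; apply/asboolP.
by exists (d * z); rewrite ?mul_absorbing ?rmorphM.
Qed.

HB.instance Definition _ := GRing.isZmodClosed.Build B image_ideal_pred image_ideal_zmod.
HB.instance Definition _ := isMulAbsorbing.Build B image_ideal_pred image_ideal_mul.

Definition image_ideal : idealType B := Ideal.clone B image_ideal_pred _.

End Image.

(** Tensoring the injection of [C / Ann(c)] into [C] with [B] sends [1 (x) 1] to [1 (x) p c = 0]. So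
    [C / Ann(c) (x) B], which is [B / p(Ann(c))], vanishes, and 1 lies in [p(Ann(c))]. *)
Lemma pure_ker_of_flat : flat_map p ->
  forall c, p c = 0 -> exists w, p w = 1 /\ w * c = 0.
Proof.
move=> pflat c pc; pose I := annihilator c; pose V := quot_ring (image_ideal I).
pose F (x : restrict (quot_pi I)) (b : restrict p) : V :=
  quot_pi (image_ideal I) (p (quot_repr x) * b).
have FE a b : F (quot_pi I a) b = quot_pi (image_ideal I) (p a * b).
  apply/quot_pi_eq; rewrite -mulrBl mulrC mul_absorbing // -rmorphB.
  apply/asboolP; exists (quot_repr (quot_pi I a) - a) => //.
  by apply/quot_pi_eq; rewrite quot_reprK.
have FB : balanced F.
  split=> [x y b|x b d|a x b]; have [x' ->] := quot_pi_surj x.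
  - by have [y' ->] := quot_pi_surj y; rewrite -raddfD /= !FE !rmorphD mulrDl rmorphD.
  - by rewrite !FE mulrDr rmorphD.
  - rewrite !restrict_scaleE; have -> : quot_pi I a * quot_pi I x' = quot_pi I (a * x').
      by rewrite rmorphM.
    by rewrite !FE (rmorphM p) mulrCA mulrA.
have t0 : pure (quot_pi I 1 : restrict (quot_pi I)) (1 : restrict p) = 0.
  apply: (pflat _ _ (annihilator_scale (c := c) : {linear _ -> _}) (@annihilator_scale_inj _ c)).
  rewrite tensor_map0 tensor_map_pure /= annihilator_scale_pi mulrC.
  rewrite -[c * 1]/(c *: (1 : regular_module C)) pureZ restrict_scaleE pc mul0r.
  by rewrite pure0r.
move: t0 => /(congr1 (tensor_lift F)); rewrite tensor_lift_pure // tensor_lift0 //.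
rewrite FE rmorph1 mulr1 -[0](rmorph0 (quot_pi (image_ideal I))) => /quot_pi_eq.
rewrite subr0 => /asboolP[w wc w1]; exists w; split=> //.
by move: wc; rewrite unfold_in => /eqP.
Qed.

End PureKernel.

(** * Maps out of quotient rings, and the tensor square of an algebra *)

Section QuotientLift.
Variables (A T : comPzRingType) (I : idealType A) (h : {rmorphism A -> T}).
Hypothesis hI : forall a, a \in I -> h a = 0.

(** The vanishing hypothesis is an argument so that the morphism structures, which depend on it, can
    be inferred from the term. *)
Definition quot_lift of (forall a, a \in I -> h a = 0) :=
  fun x : quot_ring I => h (quot_repr x).

Lemma quot_lift_pi a : quot_lift hI (quot_pi I a) = h a.
Proof.
apply/eqP; rewrite -subr_eq0 -rmorphB; apply/eqP/hI.
by apply/quot_pi_eq; rewrite quot_reprK.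
Qed.

Lemma quot_lift_zmod : zmod_morphism (quot_lift hI).
Proof.
move=> x y; have [a ->] := quot_pi_surj x; have [b ->] := quot_pi_surj y.
by rewrite -raddfB !quot_lift_pi rmorphB.
Qed.

Lemma quot_lift_monoid : monoid_morphism (quot_lift hI).
Proof.
split=> [|x y]; first by rewrite -(rmorph1 (quot_pi I)) quot_lift_pi rmorph1.
have [a ->] := quot_pi_surj x; have [b ->] := quot_pi_surj y.
by rewrite -rmorphM !quot_lift_pi rmorphM.
Qed.

HB.instance Definition _ :=
  GRing.isZmodMorphism.Build (quot_ring I) T (quot_lift hI) quot_lift_zmod.
HB.instance Definition _ :=
  GRing.isMonoidMorphism.Build (quot_ring I) T (quot_lift hI) quot_lift_monoid.

End QuotientLift.

Section TensorSquare.
Variables (R S : comPzRingType) (g : {rmorphism R -> S}).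

Local Notation "s \ox t" := (@pure R (restrict g) (restrict g) s t : tensor_alg g g)
  (at level 40).

Lemma tensor_algM (s t s' t' : S) : (s \ox t) * (s' \ox t') = (s * s') \ox (t * t').
Proof. exact: tensor_mul_pure. Qed.

Lemma mult_map_surj (s : S) : exists c, mult_map g c = s.
Proof. by exists (s \ox 1); rewrite mult_map_pure mulr1. Qed.

Lemma mult_ker_pure :
  (forall b : S, exists w, (b \ox 1 - 1 \ox b) * w = 0 /\ mult_map g w = 1) ->
  forall c, mult_map g c = 0 -> exists w, mult_map g w = 1 /\ w * c = 0.
Proof.
move=> sep c c0.
(* This form makes sense for every [c] and is stable under differences, by multiplying the two [w];
   so only pure tensors remain. *)
suff [w [w1 wc]] : exists w, mult_map g w = 1 /\ w * c = w * (mult_map g c \ox 1).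
  by exists w; rewrite w1 wc c0 pure0l mulr0.
elim/tensor_ind: c {c0} => [|x y [w [w1 wx]] [v [v1 vy]]|s t].
- by exists 1; rewrite !rmorph0 rmorph1 pure0l !mulr0.
- exists (w * v); rewrite rmorphM rmorphB /= w1 v1 mulr1; split=> //.
  have -> : (mult_map g x - mult_map g y) \ox 1 =
    mult_map g x \ox 1 - mult_map g y \ox 1 by exact: pureBl.
  by rewrite !mulrBr mulrAC wx mulrAC -(mulrA w v y) vy mulrA.
have [w [wt w1]] := sep t; exists w; split=> //.
rewrite mult_map_pure.
have -> : s \ox t = (s \ox 1) * (1 \ox t) by rewrite tensor_algM mul1r mulr1.
have -> : (s * t) \ox 1 = (s \ox 1) * (t \ox 1) by rewrite tensor_algM mulr1.
apply/eqP; rewrite eq_sym -subr_eq0 -!mulrBr mulrCA; apply/eqP.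
by rewrite (mulrC w) wt mulr0.
Qed.

(* The elements of [L] are [q] times orthogonal idempotents summing to 1, on
   each of which [b] agrees with an element of [R] after inverting [q]. *)
Lemma separating_elt (b : S) (q : int) (L : seq S) :
  (forall e, e \in L -> e * e = q%:~R * e /\ exists r, q%:~R * b * e = g r * e) ->
  \sum_(e <- L) e = q%:~R ->
  (* The sum of the [e (x) e] cuts out the blocks on which [b] is constant; the extra factor [q]
     allows [q b e] to be replaced by [g r * e] and moved across the tensor sign. *)
  exists w, (b \ox 1 - 1 \ox b) * w = 0 /\ mult_map g w = q%:~R ^+ 3.
Proof.
move=> HL sumL; exists (\sum_(e <- L) (q%:~R * e) \ox e); split.
  rewrite mulr_sumr big_seq big1 // => e /HL[_ [r be]].
  rewrite mulrBl !tensor_algM mul1r mul1r mulrCA mulrA be.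
  rewrite -(rmorph_int g) -[X in X \ox e]restrict_scaleE.
  rewrite -[X in X \ox (b * e)]restrict_scaleE !pureZ.
  by rewrite !restrict_scaleE rmorph_int mulrA be subrr.
rewrite rmorph_sum /= (eq_big_seq (fun e => q%:~R ^+ 2 * e)) => [|e /HL[ee _]].
  by rewrite -mulr_sumr sumL -exprSr.
by rewrite mult_map_pure -mulrA ee mulrA.
Qed.

End TensorSquare.

Section TensorInclusions.
Variables (R S : comPzRingType) (g : {rmorphism R -> S}).

Local Notation "s \ox t" := (@pure R (restrict g) (restrict g) s t : tensor_alg g g)
  (at level 40).

Definition tensor_inl (s : S) : tensor_alg g g := s \ox 1.
Definition tensor_inr (s : S) : tensor_alg g g := 1 \ox s.

Lemma tensor_inl_zmod : zmod_morphism tensor_inl.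
Proof. by move=> s t; apply: pureBl. Qed.

Lemma tensor_inr_zmod : zmod_morphism tensor_inr.
Proof.
move=> s t; apply: (addIr (tensor_inr t)); rewrite subrK.
by rewrite -[LHS]pureDr subrK.
Qed.

Lemma tensor_inl_monoid : monoid_morphism tensor_inl.
Proof. by split=> // s t; rewrite tensor_algM mulr1. Qed.

Lemma tensor_inr_monoid : monoid_morphism tensor_inr.
Proof. by split=> // s t; rewrite tensor_algM mulr1. Qed.

HB.instance Definition _ :=
  GRing.isZmodMorphism.Build S (tensor_alg g g) tensor_inl tensor_inl_zmod.
HB.instance Definition _ :=
  GRing.isMonoidMorphism.Build S (tensor_alg g g) tensor_inl tensor_inl_monoid.
HB.instance Definition _ :=
  GRing.isZmodMorphism.Build S (tensor_alg g g) tensor_inr tensor_inr_zmod.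
HB.instance Definition _ :=
  GRing.isMonoidMorphism.Build S (tensor_alg g g) tensor_inr tensor_inr_monoid.

Lemma tensor_inlr (s t : S) : s \ox t = tensor_inl s * tensor_inr t.
Proof. by rewrite tensor_algM mulr1 mul1r. Qed.

Lemma tensor_inl_base a : tensor_inl (g a) = tensor_inr (g a).
Proof.
have := @pureZ R (restrict g) (restrict g) a 1 1.
by rewrite !restrict_scaleE !mulr1.
Qed.

(** Flatness is used twice: to pass regularity of [a] from [R] to [S], then from [S] to the tensor
    square. *)
Lemma tensor_inl_regular (a : R) : flat_map g -> injective ( *%R a) ->
  injective ( *%R (tensor_inl (g a))).
Proof.
move=> gflat a_inj; have mulE (t : tensor_alg g g) :
    tensor_inl (g a) * t = a *: (t : tensor (restrict g) (restrict g)).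
  elim/tensor_ind: t => [|x y Hx Hy|s t]; first by rewrite mulr0 scaler0.
    by rewrite mulrBr Hx Hy scalerBr.
  by rewrite tensor_algM mul1r [RHS]tensor_scale_pure restrict_scaleE.
move=> x y; rewrite !mulE; apply: flat_scale_inj => //.
exact: (flat_regular gflat a_inj).
Qed.

End TensorInclusions.

Section TensorPair.
Variables (R S T : comPzRingType) (g : {rmorphism R -> S}) (h k : {rmorphism S -> T}).
Hypothesis hk : forall r, h (g r) = k (g r).

Local Notation "s \ox t" := (@pure R (restrict g) (restrict g) s t : tensor_alg g g)
  (at level 40).

Lemma tensor_pair_sig :
  {m : {rmorphism tensor_alg g g -> T} | forall s t, m (s \ox t) = h s * k t}.
Proof.
pose F (s t : restrict g) : T := h s * k t.
have FB : balanced F.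
  split=> [s s' t|s t t'|a s t]; rewrite /F.
  - by rewrite rmorphD mulrDl.
  - by rewrite rmorphD mulrDr.
  - by rewrite !restrict_scaleE !rmorphM hk mulrCA mulrA.
have mE s t : tensor_lift F (s \ox t) = h s * k t by exact: tensor_lift_pure.
have mB : zmod_morphism (tensor_lift F : tensor_alg g g -> T) by exact: tensor_liftB.
have m0 : tensor_lift F 0 = 0 by exact: tensor_lift0.
have mM : monoid_morphism (tensor_lift F : tensor_alg g g -> T).
  split=> [|x y]; first by rewrite mE !rmorph1 mulr1.
  elim/tensor_ind: x => [|x x' Hx Hx'|s t]; first by rewrite mul0r !m0 mul0r.
    by rewrite mulrBl !mB Hx Hx' mulrBl.
  elim/tensor_ind: y => [|y y' Hy Hy'|s' t']; first by rewrite mulr0 !m0 mulr0.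
    by rewrite mulrBr !mB Hy Hy' mulrBr.
  by rewrite tensor_algM !mE !rmorphM mulrACA.
pose zM := GRing.isZmodMorphism.Build _ _ (tensor_lift F : tensor_alg g g -> T) mB.
pose mMM := GRing.isMonoidMorphism.Build _ _ (tensor_lift F : tensor_alg g g -> T) mM.
pose m : {rmorphism tensor_alg g g -> T} := HB.pack (tensor_lift F : tensor_alg g g -> T) zM mMM.
by exists m.
Qed.

Definition tensor_pair : {rmorphism tensor_alg g g -> T} := sval tensor_pair_sig.

Lemma tensor_pair_pure s t : tensor_pair (s \ox t) = h s * k t.
Proof. exact: (svalP tensor_pair_sig). Qed.

End TensorPair.



Lemma dvdz_subM (d a b a' b' : int) :
  (d %| a - b)%Z -> (d %| a' - b')%Z -> (d %| a * a' - b * b')%Z.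
Proof.
move=> dab dab'; have -> : a * a' - b * b' = (a - b) * a' + b * (a' - b') by ring.
by apply: rpredD; [apply: dvdz_mulr | apply: dvdz_mull].
Qed.

(** * The chain of lines *)

Definition shift : option int -> option int := omap (fun n => n + 1).
Definition unshift : option int -> option int := omap (fun n => n - 1).

Lemma shiftK : cancel shift unshift.
Proof. by case=> //= n; rewrite addrK. Qed.

Lemma unshiftK : cancel unshift shift.
Proof. by case=> //= n; rewrite subrK. Qed.

Definition index_fun : comPzRingType := (option int -> int).

(* [f.1 s] and [f.2 s] are the values on the [s]-th copies of the lines [X = 0]
   and [X = 6], with [None] for the limit point: copies with the same index meet
   at the prime 2, and the [s]-th copy of the first line meets the [s+1]-st copy
   of the second one at the prime 3. *)
Definition glued (f : index_fun * index_fun) : bool :=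
  `[< [/\ forall s, (2 %| f.1 s - f.2 s)%Z,
          forall s, (3 %| f.1 s - f.2 (shift s))%Z &
          exists T : seq int, forall n, n \notin T ->
            f.1 (Some n) = f.1 None /\ f.2 (Some n) = f.2 None] >].

Lemma glued_subring : subring_closed glued.
Proof.
split; first by apply/asboolP; split=> //; exists [::].
- move=> f h /asboolP[f2 f3 [T fT]] /asboolP[h2 h3 [U hU]]; apply/asboolP.
  have dvdB d (a b a' b' : int) : (d %| a - b)%Z -> (d %| a' - b')%Z ->
      (d %| (a - a') - (b - b'))%Z.
    move=> dab dab'; have -> : a - a' - (b - b') = (a - b) - (a' - b') by ring.
    exact: rpredB.
  split=> [s|s|]; [exact: dvdB (f2 s) (h2 s) | exact: dvdB (f3 s) (h3 s) |].
  exists (T ++ U) => n; rewrite mem_cat negb_or => /andP[/fT[f1 f2'] /hU[h1 h2']].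
  by split; [apply: (congr2 (fun a b => a - b) f1 h1)
            | apply: (congr2 (fun a b => a - b) f2' h2')].
- move=> f h /asboolP[f2 f3 [T fT]] /asboolP[h2 h3 [U hU]]; apply/asboolP.
  split=> [s|s|]; [exact: dvdz_subM (f2 s) (h2 s) | exact: dvdz_subM (f3 s) (h3 s) |].
  exists (T ++ U) => n; rewrite mem_cat negb_or => /andP[/fT[f1 f2'] /hU[h1 h2']].
  by split; [apply: (congr2 *%R f1 h1) | apply: (congr2 *%R f2' h2')].
Qed.

HB.instance Definition _ :=
  GRing.isSubringClosed.Build (index_fun * index_fun)%type glued glued_subring.

Record chain := Chain { chain_val : index_fun * index_fun; _ : chain_val \in glued }.

HB.instance Definition _ := [isSub for chain_val].
HB.instance Definition _ := [Choice of chain by <:].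
HB.instance Definition _ := GRing.SubChoice_isSubComPzRing.Build
  (index_fun * index_fun)%type glued chain glued_subring.

Definition line1 (s : option int) (f : chain) : int := (val f).1 s.
Definition line2 (s : option int) (f : chain) : int := (val f).2 s.

HB.instance Definition _ (n : option int) := GRing.isZmodMorphism.Build chain int (line1 n)
  (fun _ _ => erefl).
HB.instance Definition _ (n : option int) := GRing.isMonoidMorphism.Build chain int (line1 n)
  (conj erefl (fun _ _ => erefl)).
HB.instance Definition _ (n : option int) := GRing.isZmodMorphism.Build chain int (line2 n)
  (fun _ _ => erefl).
HB.instance Definition _ (n : option int) := GRing.isMonoidMorphism.Build chain int (line2 n)
  (conj erefl (fun _ _ => erefl)).

Lemma chainP (f : chain) :
  [/\ forall s, (2 %| line1 s f - line2 s f)%Z,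
      forall s, (3 %| line1 s f - line2 (shift s) f)%Z &
      exists T : seq int, forall n, n \notin T ->
        line1 (Some n) f = line1 None f /\ line2 (Some n) f = line2 None f].
Proof. exact/asboolP/(valP f). Qed.

Lemma chain_ext (f h : chain) :
  (forall s, line1 s f = line1 s h) -> (forall s, line2 s f = line2 s h) -> f = h.
Proof.
move=> fh1 fh2; apply: val_inj.
by apply: injective_projections; apply: funext.
Qed.

Lemma chain_make (u v : option int -> int) :
  (forall s, (2 %| u s - v s)%Z) -> (forall s, (3 %| u s - v (shift s))%Z) ->
  (exists T : seq int, forall n, n \notin T ->
     u (Some n) = u None /\ v (Some n) = v None) ->
  exists f : chain, (forall s, line1 s f = u s) /\ (forall s, line2 s f = v s).
Proof.
move=> uv2 uv3 uvT.
have uvP : (u, v) \in glued by apply/asboolP.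
by exists (Chain uvP).
Qed.

Definition base : comPzRingType := {poly int}.

Definition nodes_pred (p : base) : bool :=
  ((p : {poly int}).[0] == 0) && ((p : {poly int}).[6] == 0).

Lemma nodes_zmod : zmod_closed nodes_pred.
Proof.
split=> [|p q]; rewrite !unfold_in /nodes_pred ?horner0 //.
by move=> /andP[/eqP p0 /eqP p6] /andP[/eqP q0 /eqP q6]; rewrite !hornerE p0 p6 q0 q6.
Qed.

Lemma nodes_mul (p q : base) : q \in nodes_pred -> p * q \in nodes_pred.
Proof.
rewrite !unfold_in /nodes_pred => /andP[/eqP q0 /eqP q6].
by rewrite !hornerE q0 q6 !mulr0.
Qed.

HB.instance Definition _ := GRing.isZmodClosed.Build base nodes_pred nodes_zmod.
HB.instance Definition _ := isMulAbsorbing.Build base nodes_pred nodes_mul.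

Definition nodes : idealType base := Ideal.clone base nodes_pred _.

(** [p - p.[0]] is a multiple of [X], so 6 divides its value at 6. *)
Lemma const_glued (p : base) :
  (fun _ => (p : {poly int}).[0], fun _ => (p : {poly int}).[6]) \in glued.
Proof.
have dvd6 : (6 %| (p : {poly int}).[0] - p.[6])%Z.
  have /factor_theorem[q pq] : root ((p : {poly int}) - p.[0]%:P) 0.
    by rewrite /root !hornerE subrr.
  have := congr1 (fun r : {poly int} => r.[6]) pq; rewrite !hornerE => p6.
  by rewrite -opprB p6 rpredN dvdz_mull.
apply/asboolP; split=> [s|s|] /=; last by exists [::].
  by rewrite (dvdz_trans _ dvd6).
by rewrite (dvdz_trans _ dvd6).
Qed.

Definition const_chain (p : base) : chain := Chain (const_glued p).

Lemma const_chain_zmod : zmod_morphism const_chain.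
Proof. by move=> p q; apply: chain_ext => s; rewrite raddfB; apply: (raddfB (horner_eval _)). Qed.

Lemma const_chain_monoid : monoid_morphism const_chain.
Proof.
split=> [|p q]; apply: chain_ext => s; rewrite ?rmorph1 ?rmorphM /=;
  [exact: hornerC | exact: hornerC | exact: hornerM | exact: hornerM].
Qed.

HB.instance Definition _ :=
  GRing.isZmodMorphism.Build base chain const_chain const_chain_zmod.
HB.instance Definition _ :=
  GRing.isMonoidMorphism.Build base chain const_chain const_chain_monoid.

Lemma const_chain_nodes p : p \in nodes -> const_chain p = 0.
Proof. by move=> /andP[/eqP p0 /eqP p6]; apply: chain_ext => s; rewrite rmorph0. Qed.

(* Opaque, so that simplification does not unfold applications of the map. *)
Lemma chain_map_sig : {h : {rmorphism quot_ring nodes -> chain} |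
  forall p, h (quot_pi nodes p) = const_chain p}.
Proof. by exists (quot_lift const_chain_nodes) => p; apply: quot_lift_pi. Qed.

Definition chain_map : {rmorphism quot_ring nodes -> chain} := sval chain_map_sig.

Lemma chain_map_pi p : chain_map (quot_pi nodes p) = const_chain p.
Proof. exact: (svalP chain_map_sig). Qed.

Lemma line1_map s p : line1 s (chain_map (quot_pi nodes p)) = (p : {poly int}).[0].
Proof. by rewrite chain_map_pi. Qed.

Lemma line2_map s p : line2 s (chain_map (quot_pi nodes p)) = (p : {poly int}).[6].
Proof. by rewrite chain_map_pi. Qed.

Lemma base_quot_ext (x y : quot_ring nodes) :
  line1 None (chain_map x) = line1 None (chain_map y) ->
  line2 None (chain_map x) = line2 None (chain_map y) -> x = y.
Proof.
have [p ->] := quot_pi_surj x; have [q ->] := quot_pi_surj y.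
rewrite !line1_map !line2_map => pq0 pq6; apply/quot_pi_eq.
by apply/andP; rewrite !hornerE pq0 pq6 !subrr.
Qed.

(** The affine polynomial with value [a] at 0; its value at 6 is [b] when the division is exact. *)
Definition interpolate (a b : int) : quot_ring nodes :=
  quot_pi nodes (a%:P + ((b - a) %/ 6)%Z *: 'X : {poly int}).

Lemma line1_interpolate s a b : line1 s (chain_map (interpolate a b)) = a.
Proof. by rewrite line1_map !hornerE. Qed.

Lemma line2_interpolate s a b : (6 %| a - b)%Z ->
  line2 s (chain_map (interpolate a b)) = b.
Proof. by rewrite line2_map !hornerE; lia. Qed.

(** * The chain after inverting 2 or 3 *)

Lemma sum_indicator (T : seq int) (F : int -> int) (s : option int) : uniq T ->
  \sum_(n <- T) F n * (s == Some n)%:R = if s is Some n then F n *+ (n \in T) else 0.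
Proof.
case: s => [m|] uT; last by rewrite big1 // => n _; rewrite mulr0.
have [mT|mT] := boolP (m \in T).
  rewrite (bigD1_seq m) //= eqxx mulr1 big1 ?addr0 // => n nm.
  by rewrite (inj_eq Some_inj) eq_sym (negbTE nm) mulr0.
rewrite big_seq big1 // => n nT; have [nm|] := eqVneq (Some m) (Some n); last by rewrite mulr0.
by case: nm nT mT => -> ->.
Qed.

(* After inverting [q], the algebra [chain] becomes the algebra of locally constant
   functions on the index set; [tau s] is the copy of the second line matched
   with the [s]-th copy of the first one, and [E n / q] the indicator of [n]. *)
Section Trivialization.
Variables (q : int) (tau untau : option int -> option int) (E : int -> chain).
Hypotheses (untauK : cancel untau tau) (tauN : tau None = None).
Hypothesis line1_E : forall n s, line1 s (E n) = q * (s == Some n)%:R.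
Hypothesis line2_E : forall n s, line2 (tau s) (E n) = q * (s == Some n)%:R.
Hypothesis dvd6 : forall f s, (6 %| q * line1 s f - q * line2 (tau s) f)%Z.

(** The values of [q f] on the matched pair of lines [s] and [tau s], as an element of the quotient
    ring; [dvd6] makes the interpolation exact. *)
Definition coord (s : option int) (f : chain) : quot_ring nodes :=
  interpolate (q * line1 s f) (q * line2 (tau s) f).

Lemma line1_coord s s' f : line1 s' (chain_map (coord s f)) = q * line1 s f.
Proof. exact: line1_interpolate. Qed.

Lemma line2_coord s s' f : line2 s' (chain_map (coord s f)) = q * line2 (tau s) f.
Proof. by rewrite line2_interpolate. Qed.

Lemma coordD s f h : coord s (f + h) = coord s f + coord s h.
Proof.
by apply: base_quot_ext; rewrite !rmorphD /= !(line1_coord, line2_coord) rmorphD mulrDr.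
Qed.

Lemma coordM s a f : coord s (chain_map a * f) = a * coord s f.
Proof.
have [p ->] := quot_pi_surj a.
by apply: base_quot_ext; rewrite !rmorphM /= !(line1_coord, line2_coord) rmorphM /=
  !(line1_map, line2_map) mulrCA.
Qed.

Definition stable_off (T : seq int) (f : chain) : Prop :=
  forall n, n \notin T ->
    line1 (Some n) f = line1 None f /\ line2 (tau (Some n)) f = line2 None f.

Hypothesis stable_ex : forall f, exists T, stable_off T f.

Lemma chain_ext_tau (f h : chain) : (forall s, line1 s f = line1 s h) ->
  (forall s, line2 (tau s) f = line2 (tau s) h) -> f = h.
Proof. by move=> ? fh2; apply: chain_ext => // s; rewrite -(untauK s). Qed.

(** A locally constant function is its value at the limit point plus a correction at each [n] in
    [T]. Coordinates and indicators each carry a factor [q], whence [q ^+ 2]. *)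
Lemma chain_expand T f : uniq T -> stable_off T f ->
  (q ^+ 2)%:~R * f =
    \sum_(n <- T) chain_map (coord (Some n) f - coord None f) * E n
    + chain_map (coord None f) * q%:~R.
Proof.
move=> uT fT; apply: chain_ext_tau => s.
  rewrite rmorphD !rmorphM !rmorph_int rmorph_sum /= !intz line1_coord.
  under eq_bigr => n _ do
    rewrite rmorphM !rmorphB /= !line1_coord line1_E mulrA.
  rewrite sum_indicator //; case: s => [n|]; last by ring.
  by have [nT|/fT[-> _]] := boolP (n \in T); rewrite ?mulr1n ?mulr0n; ring.
rewrite rmorphD !rmorphM !rmorph_int rmorph_sum /= !intz line2_coord.
under eq_bigr => n _ do
  rewrite rmorphM !rmorphB /= !line2_coord line2_E mulrA.
rewrite sum_indicator //; case: s => [n|]; rewrite tauN; last by ring.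
by have [nT|/fT[_ ->]] := boolP (n \in T); rewrite ?mulr1n ?mulr0n; ring.
Qed.

Section TensorCoord.
Variable M : lmodType (quot_ring nodes).
Local Notation N := (restrict chain_map).

Definition tensor_coord (s : option int) : tensor M N -> M :=
  tensor_lift (fun m (f : N) => coord s f *: m).

Lemma tensor_coord_balanced s : balanced (fun (m : M) (f : N) => coord s f *: m).
Proof.
split=> [m m' f|m f h|a m f]; first exact: scalerDr.
  by rewrite coordD scalerDl.
by rewrite restrict_scaleE coordM scalerA mulrC.
Qed.

(** [chain_expand] with coefficients in [M]. Allowing every larger [T] lets the expansions of two
    tensors be taken over a common set. *)
Lemma tensor_expand (t : tensor M N) : exists T0 : seq int,
  forall T, uniq T -> {subset T0 <= T} ->
  (q ^+ 2)%:~R *: t =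
    \sum_(n <- T) pure (tensor_coord (Some n) t - tensor_coord None t) (E n : N)
    + pure (tensor_coord None t) (q%:~R : N).
Proof.
have coordE s m f : tensor_coord s (pure m f) = coord s f *: m.
  exact/tensor_lift_pure/tensor_coord_balanced.
have coord0 s : tensor_coord s 0 = 0 by exact/tensor_lift0/tensor_coord_balanced.
have coordB s : zmod_morphism (tensor_coord s).
  exact/tensor_liftB/tensor_coord_balanced.
elim/tensor_ind: t => [|x y [Tx Hx] [Ty Hy]|m f].
- exists [::] => T _ _; rewrite !coord0 scaler0 pure0l addr0 big1 // => n _.
  by rewrite !coord0 subrr pure0l.
- exists (Tx ++ Ty) => T uT sub.
  have subx : {subset Tx <= T} by move=> n nT; apply: sub; rewrite mem_cat nT.
  have suby : {subset Ty <= T} by move=> n nT; apply: sub; rewrite mem_cat nT orbT.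
  rewrite scalerBr (Hx T uT subx) (Hy T uT suby).
  rewrite opprD addrACA -sumrB !coordB pureBl; congr (_ + _).
  apply: eq_bigr => n _; rewrite -pureBl !coordB; congr pure.
  by rewrite !opprD !opprK addrACA.
have [T0 fT0] := stable_ex f; exists T0 => T uT sub.
have /chain_expand -/(_ uT) fE : stable_off T f.
  by move=> n nT; apply: fT0; apply: contra nT; apply: sub.
have -> : (q ^+ 2)%:~R *: pure m (f : N) = pure m ((q ^+ 2)%:~R * f : N).
  rewrite -[(q ^+ 2)%:~R * f](_ : (q ^+ 2)%:~R *: (f : N) = _) -?pureZ ?[_ *: pure _ _]tensor_scale_pure //.
  by rewrite restrict_scaleE rmorph_int.
rewrite fE !coordE pureDr; congr (_ + _); last first.
  by rewrite pureZ restrict_scaleE.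
elim: T {uT sub fE} => [|n T IH]; first by rewrite !big_nil pure0r.
by rewrite !big_cons pureDr IH !coordE -scalerBl pureZ restrict_scaleE.
Qed.

End TensorCoord.

(** Coordinates commute with [u], so by injectivity those of [t] vanish, and [q ^+ 2] times [t] is
    expressed through them. *)
Lemma tensor_map_ker_trivialized (M M' : lmodType (quot_ring nodes))
    (u : {linear M -> M'}) (t : tensor M (restrict chain_map)) :
  injective u -> tensor_map (restrict chain_map) u t = 0 -> (q ^+ 2)%:~R *: t = 0.
Proof.
move=> u_inj ut0.
have nat_coord s x : tensor_coord s (tensor_map (restrict chain_map) u x) = u (tensor_coord s x).
  have tcB L := tensor_liftB (tensor_coord_balanced L s).
  have tc0 L := tensor_lift0 (tensor_coord_balanced L s).
  elim/tensor_ind: x => [|x y Hx Hy|m f].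
  - by rewrite tensor_map0 [LHS]tc0 [tensor_coord s 0]tc0 raddf0.
  - by rewrite tensor_mapB [LHS]tcB [tensor_coord s (x - y)]tcB raddfB; congr (_ - _).
  - rewrite tensor_map_pure [LHS](tensor_lift_pure (tensor_coord_balanced M' s)).
    by rewrite [tensor_coord s _](tensor_lift_pure (tensor_coord_balanced M s)) linearZ.
have t0 s : tensor_coord s t = 0.
  apply: u_inj; rewrite -nat_coord ut0 raddf0.
  exact: (tensor_lift0 (tensor_coord_balanced M' s)).
have [T0 tE] := tensor_expand t.
rewrite (tE (undup T0)) ?undup_uniq // => [|n]; last by rewrite mem_undup.
by rewrite t0 pure0l addr0 big1 // => n _; rewrite !t0 subrr pure0l.
Qed.

Local Notation "s \ox t" := (@pure _ (restrict chain_map) (restrict chain_map) s t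
  : tensor_alg chain_map chain_map) (at level 40).

Lemma separating_trivialized (b : chain) : exists w,
  (b \ox 1 - 1 \ox b) * w = 0 /\ mult_map chain_map w = q%:~R ^+ 3.
Proof.
have [T0 bT0] := stable_ex b; pose T := undup T0; have uT : uniq T := undup_uniq _.
have bT : stable_off T b by move=> n nT; apply: bT0; rewrite -mem_undup.
(* [q] times the indicator of the complement of [T], where [b] has its limit values. *)
pose Einf : chain := q%:~R - \sum_(n <- T) E n.
have line1_sum s : line1 s (\sum_(n <- T) E n) = if s is Some n then q *+ (n \in T) else 0.
  by rewrite rmorph_sum /= -(sum_indicator (fun=> q)) //; apply: eq_bigr => n _; rewrite line1_E.
have line2_sum s : line2 (tau s) (\sum_(n <- T) E n) = if s is Some n then q *+ (n \in T) else 0.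
  by rewrite rmorph_sum /= -(sum_indicator (fun=> q)) //; apply: eq_bigr => n _; rewrite line2_E.
have line1_inf s : line1 s Einf = q - if s is Some n then q *+ (n \in T) else 0.
  by rewrite rmorphB /= rmorph_int line1_sum intz.
have line2_inf s : line2 (tau s) Einf = q - if s is Some n then q *+ (n \in T) else 0.
  by rewrite rmorphB /= rmorph_int line2_sum intz.
apply: (@separating_elt _ _ chain_map b q (Einf :: [seq E n | n <- T])); last first.
  by rewrite big_cons big_map subrK.
move=> e; rewrite inE => /predU1P[->|/mapP[n _ ->]]; split.
- apply: chain_ext_tau => s.
    rewrite !rmorphM !rmorph_int /= !line1_inf !intz.
    by case: s => [n|]; first case: (n \in T); rewrite ?mulr1n ?mulr0n; ring.
  rewrite !rmorphM !rmorph_int /= !line2_inf !intz.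
  by case: s => [n|]; first case: (n \in T); rewrite ?mulr1n ?mulr0n; ring.
- exists (coord None b); apply: chain_ext_tau => s.
    rewrite !rmorphM !rmorph_int /= !line1_inf !intz line1_coord.
    case: s => [n|//]; first have [nT|/bT[-> _]] := boolP (n \in T); rewrite ?mulr1n ?mulr0n; ring.
  rewrite !rmorphM !rmorph_int /= !line2_inf !intz line2_coord tauN.
  case: s => [n|]; rewrite ?tauN //.
  have [nT|/bT[_ ->]] := boolP (n \in T); rewrite ?mulr1n ?mulr0n; ring.
- apply: chain_ext_tau => s; rewrite !rmorphM !rmorph_int /= ?line1_E ?line2_E !intz;
  by case: (s == _); rewrite /= ?mulr1n ?mulr0n; ring.
exists (coord (Some n) b); apply: chain_ext_tau => s.
  rewrite !rmorphM !rmorph_int /= ?line1_E line1_coord !intz.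
  by have [->|_] := eqVneq s (Some n); rewrite /= ?eqxx ?mulr1n ?mulr0n; ring.
rewrite !rmorphM !rmorph_int /= ?line2_E line2_coord !intz.
by have [->|_] := eqVneq s (Some n); rewrite /= ?eqxx ?mulr1n ?mulr0n; ring.
Qed.

End Trivialization.

(** * The two trivializations, and weak étaleness *)

(** Inverting 3 removes the nodes at 3 and leaves those at 2, which match lines of equal index. *)
Lemma indicator3_ex (n : int) : exists f : chain,
  (forall s, line1 s f = 3 * (s == Some n)%:R) /\
  (forall s, line2 s f = 3 * (s == Some n)%:R).
Proof.
apply: chain_make => [s|s|]; first by rewrite subrr.
  by rewrite -mulrBr dvdz_mulr.
exists [:: n] => m; rewrite inE => /negbTE mn.
by rewrite (inj_eq Some_inj) mn.
Qed.

Definition indicator3 (n : int) : chain := projT1 (cid (indicator3_ex n)).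

Lemma line1_indicator3 n s : line1 s (indicator3 n) = 3 * (s == Some n)%:R.
Proof. by rewrite /indicator3; case: cid => f [/= fE _]. Qed.

Lemma line2_indicator3 n s : line2 s (indicator3 n) = 3 * (s == Some n)%:R.
Proof. by rewrite /indicator3; case: cid => f [/= _ fE]. Qed.

(** Inverting 2 leaves the nodes at 3, which match line [s] with line [shift s]. *)
Lemma indicator2_ex (n : int) : exists f : chain,
  (forall s, line1 s f = 2 * (s == Some n)%:R) /\
  (forall s, line2 s f = 2 * (unshift s == Some n)%:R).
Proof.
apply: chain_make => [s|s|]; first by rewrite -mulrBr dvdz_mulr.
  by rewrite shiftK subrr.
(* On the second lines the nonzero value sits at index [n + 1]. *)
exists [:: n; n + 1] => m; rewrite !inE negb_or => /andP[/negbTE mn mn1].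
by rewrite !(inj_eq Some_inj) mn subr_eq (negbTE mn1).
Qed.

Definition indicator2 (n : int) : chain := projT1 (cid (indicator2_ex n)).

Lemma line1_indicator2 n s : line1 s (indicator2 n) = 2 * (s == Some n)%:R.
Proof. by rewrite /indicator2; case: cid => f [/= fE _]. Qed.

Lemma line2_indicator2 n s : line2 (shift s) (indicator2 n) = 2 * (s == Some n)%:R.
Proof. by rewrite /indicator2; case: cid => f [/= _ ->]; rewrite shiftK. Qed.

Lemma dvd6_id f s : (6 %| 3 * line1 s f - 3 * line2 s f)%Z.
Proof. by have [/(_ s) + _ _] := chainP f; lia. Qed.

Lemma dvd6_shift f s : (6 %| 2 * line1 s f - 2 * line2 (shift s) f)%Z.
Proof. by have [_ /(_ s) + _] := chainP f; lia. Qed.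

Lemma stable_id f : exists T, stable_off id T f.
Proof. by have [_ _ []] := chainP f => T fT; exists T. Qed.

Lemma stable_shift f : exists T, stable_off shift T f.
Proof.
have [_ _ [T fT]] := chainP f; exists (T ++ [seq n - 1 | n <- T]) => n.
rewrite mem_cat negb_or => /andP[/fT[-> _] nT]; split=> //=.
apply: (fT (n + 1) _).2; apply: contra nT => nT.
by apply/mapP; exists (n + 1); rewrite ?addrK.
Qed.

Theorem chain_map_weakly_etale : weakly_etale chain_map.
Proof.
split.
  apply: flat_ker => M M' u u_inj t ut0.
  have t9 := tensor_map_ker_trivialized (frefl id) erefl line1_indicator3 line2_indicator3
    dvd6_id stable_id u_inj ut0.
  have t4 := tensor_map_ker_trivialized unshiftK erefl line1_indicator2 line2_indicator2
    dvd6_shift stable_shift u_inj ut0.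
  (* Both 9 and 4 kill [t], and 9 - 2 * 4 = 1. *)
  rewrite -[t]scale1r (_ : 1 = (3 ^+ 2)%:~R - 2%:~R * (2 ^+ 2)%:~R) //; last first.
    by rewrite -intrM -intrB.
  by rewrite scalerBl -scalerA t9 t4 scaler0 subrr.
apply: flat_of_pure_ker; first exact: mult_map_surj.
apply: mult_ker_pure => b.
have [v [bv v1]] := separating_trivialized (frefl id) erefl line1_indicator3
  line2_indicator3 dvd6_id stable_id b.
have [w [bw w1]] := separating_trivialized unshiftK erefl line1_indicator2
  line2_indicator2 dvd6_shift stable_shift b.
(* The diagonal values are 27 and 8, and 3 * 27 - 10 * 8 = 1. *)
exists (3%:~R * v - 10%:~R * w); split.
  by rewrite mulrBr !mulrA ![_ * _%:~R]mulrC -!mulrA bv bw !mulr0 subrr.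
by rewrite rmorphB !rmorphM !rmorph_int /= v1 w1 -!rmorphXn -!intrM -intrB.
Qed.

(** * Nonexistence of a lift *)

Definition eventually_const (u : option int -> int) : Prop :=
  exists T : seq int, forall n, n \notin T -> u (Some n) = u None.

(** The weights 3 and 4 solve the congruences at the nodes: they are 1 and 0 mod 2, and 0 and 1 mod
    3. *)
Lemma chain_extend1 u : eventually_const u -> exists f, forall s, line1 s f = u s.
Proof.
move=> [T uT].
have [||| f [f1 _]] := @chain_make u (fun s => 3 * u s + 4 * u (unshift s)); last by exists f.
- by move=> s; lia.
- by move=> s; rewrite shiftK; lia.
exists (T ++ [seq n + 1 | n <- T]) => n; rewrite mem_cat negb_or => /andP[nT nT1].
rewrite /= uT // uT //; apply: contra nT1 => nT1.
by apply/mapP; exists (n - 1); rewrite ?subrK.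
Qed.

Lemma chain_extend2 v : eventually_const v -> exists f, forall s, line2 s f = v s.
Proof.
move=> [T vT].
have [||| f [_ f2]] := @chain_make (fun s => 3 * v s + 4 * v (shift s)) v; last by exists f.
- by move=> s; lia.
- by move=> s; lia.
exists (T ++ [seq n - 1 | n <- T]) => n; rewrite mem_cat negb_or => /andP[nT nT1].
rewrite /= vT // vT //; apply: contra nT1 => nT1.
by apply/mapP; exists (n + 1); rewrite ?addrK.
Qed.

Lemma line1_const s p : line1 s (const_chain p) = (p : {poly int}).[0].
Proof. by []. Qed.

Lemma line2_const s p : line2 s (const_chain p) = (p : {poly int}).[6].
Proof. by []. Qed.

Definition eqn1 : base := ('X : {poly int}).
Definition eqn2 : base := ('X - 6%:P : {poly int}).

Lemma dvdz_6 (a : int) : (2 %| a)%Z -> (3 %| a)%Z -> (6 %| a)%Z.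
Proof. lia. Qed.

(** Let [w] be, on the first lines, the indicator of the zero set of [h]. Then [w h] vanishes on all
    first lines, so by gluing 2 and 3 divide its values on the second lines, where [X = 6]. *)
Lemma chain_local_div1 s (h : chain) : line1 s h = 0 ->
  exists w z, line1 s w = 1 /\ w * h = const_chain eqn1 * z.
Proof.
move=> hs; have [_ _ [T hT]] := chainP h.
have [|w w1] := @chain_extend1 (fun t => (line1 t h == 0)%:R).
  by exists T => n /hT[-> _].
have wh1 t : line1 t (w * h) = 0.
  rewrite rmorphM /= w1; have [->|_] := eqVneq; last by rewrite mul0r.
  by rewrite mulr0.
have [g2 g3 [U gU]] := chainP (w * h).
have dvd6 t : (6 %| line2 t (w * h))%Z.
  have := g2 t; have := g3 (unshift t); rewrite unshiftK !wh1 !sub0r !rpredN.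
  by move=> ? ?; apply: dvdz_6.
have [|z z2] := @chain_extend2 (fun t => (line2 t (w * h) %/ 6)%Z).
  by exists U => n /gU[_ ->].
exists w, z; split; first by rewrite w1 hs.
apply: chain_ext => t; rewrite [RHS]rmorphM /=.
  by rewrite wh1 line1_const hornerX mul0r.
by rewrite line2_const hornerX z2 [RHS]mulrC divzK.
Qed.

Lemma chain_local_div2 s (h : chain) : line2 s h = 0 ->
  exists w z, line2 s w = 1 /\ w * h = const_chain eqn2 * z.
Proof.
move=> hs; have [_ _ [T hT]] := chainP h.
have [|w w2] := @chain_extend2 (fun t => (line2 t h == 0)%:R).
  by exists T => n /hT[_ ->].
have wh2 t : line2 t (w * h) = 0.
  rewrite rmorphM /= w2; have [->|_] := eqVneq; last by rewrite mul0r.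
  by rewrite mulr0.
have [g2 g3 [U gU]] := chainP (w * h).
have dvd6 t : (6 %| line1 t (w * h))%Z.
  by have := g2 t; have := g3 t; rewrite !wh2 !subr0 => ? ?; apply: dvdz_6.
(* The sign appears because [X - 6] is -6 on the first lines. *)
have [|z z1] := @chain_extend1 (fun t => - (line1 t (w * h) %/ 6)%Z).
  by exists U => n /gU[-> _].
exists w, z; split; first by rewrite w2 hs.
apply: chain_ext => t; rewrite [RHS]rmorphM /=.
  by rewrite line1_const !hornerE z1 mulrNN [RHS]mulrC divzK.
by rewrite wh2 line2_const hornerXsubC subrr mul0r.
Qed.




(** * Local equations and vanishing to infinite order *)

(** After inverting elements of value 1, the kernel of [e] lies in the ideal of [x]; if also
    [e x = 0], then [x] is a local equation of the line given by [e]. *)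
Definition local_div (C : comPzRingType) (e : C -> int) (x : C) : Prop :=
  forall c, e c = 0 -> exists w d, e w = 1 /\ w * c = x * d.

Section TensorLocalDivision.
Variables (R S : comPzRingType) (g : {rmorphism R -> S}) (h k : {rmorphism S -> int}).
Hypothesis hk : forall r, h (g r) = k (g r).
Variable a : R.
Hypotheses (ha : h (g a) = 0) (h_div : local_div h (g a)) (k_div : local_div k (g a)).

Local Notation "s \ox t" := (@pure R (restrict g) (restrict g) s t : tensor_alg g g)
  (at level 40).

(** Locally [s] is the integer [h s] and [t] the integer [k t] modulo [X], so a pure tensor is
    locally an integer modulo [X]. *)
Lemma tensor_local_div : local_div (tensor_pair hk) (tensor_inl g (g a)).
Proof.
set m := tensor_pair hk; set X := tensor_inl g (g a).
have mX : m X = 0 by rewrite tensor_pair_pure ha mul0r.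
(* Applying [m] to the equation forces [n = m c = 0]. *)
move=> c mc; suff [w [d [n [w1 wc]]]] : exists w d (n : int),
    m w = 1 /\ w * c = w * n%:~R + X * d.
  exists w, d; split=> //; have := congr1 m wc.
  rewrite rmorphM rmorphD !rmorphM /= mc mX w1 rmorph_int mulr0 mul0r addr0 mul1r intz.
  by move=> n0; rewrite wc -n0 mulr0 add0r.
elim/tensor_ind: c {mc} => [|x y [w [d [n [w1 wx]]]] [v [e [n' [v1 vy]]]]|s t].
- by exists 1, 0, 0; rewrite rmorph1 !mulr0 addr0.
- exists (w * v), (v * d - w * e), (n - n'); rewrite rmorphM w1 v1 mulr1; split=> //.
  have -> : w * v * (x - y) = v * (w * x) - w * (v * y) by ring.
  by rewrite wx vy intrB; ring.
have /h_div[w [d [w1 wd]]] : h (s - (h s)%:~R) = 0.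
  by rewrite rmorphB rmorph_int /= intz subrr.
have /k_div[v [e [v1 ve]]] : k (t - (k t)%:~R) = 0.
  by rewrite rmorphB rmorph_int /= intz subrr.
have W : tensor_inl g w * (tensor_inl g s - (h s)%:~R) = X * tensor_inl g d.
  by rewrite -(rmorph_int (tensor_inl g)) -rmorphB -!rmorphM wd.
have V : tensor_inr g v * (tensor_inr g t - (k t)%:~R) = X * tensor_inr g e.
  by rewrite /X tensor_inl_base -(rmorph_int (tensor_inr g)) -rmorphB -!rmorphM ve.
exists (w \ox v), (tensor_inl g d * tensor_inr g v * tensor_inr g t
  + tensor_inl g w * (h s)%:~R * tensor_inr g e), (h s * k t).
split; first by rewrite tensor_pair_pure w1 v1 mulr1.
rewrite !tensor_inlr intrM.
rewrite (_ : X * (_ + _) = (X * tensor_inl g d) * (tensor_inr g v * tensor_inr g t)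
  + tensor_inl g w * (h s)%:~R * (X * tensor_inr g e)); last by ring.
by rewrite -W -V; ring.
Qed.

End TensorLocalDivision.

Section Propagation.
Variables (C : comPzRingType) (x y : C) (e1 e2 : {rmorphism C -> int}) (p : int).

(* [c] vanishes in the completion along [x] of the local ring of [C] at the
   point given by [e]. *)
Definition vanishes (e : C -> int) (x c : C) : Prop :=
  forall n, exists w d, e w = 1 /\ w * c = x ^+ n * d.

Hypotheses (p_gt1 : (1 < p)) (e12 : forall c, (p %| e1 c - e2 c)%Z).
Hypotheses (e2x : e2 x != 0) (p_e2x : (p %| e2 x)%Z) (e2y : e2 y = 0).
Hypotheses (y_reg : injective ( *%R y)) (y_div : local_div e2 y).

Lemma dvdz_expn_eq0 (a : int) : (forall n, (p ^+ n %| a)%Z) -> a = 0.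
Proof.
move=> pa; apply/eqP; apply: contraT => a0.
(* The exponent [|a|] suffices, since [p ^ |a|] exceeds [|a|]. *)
have := pa `|a|%N; rewrite dvdzE abszX => /dvdn_leq.
rewrite absz_gt0 a0 => /(_ isT); rewrite leqNgt ltn_expl //; lia.
Qed.

(** As [e2 y = 0] and [e2 x] is nonzero, [e2] kills [h]; so [y] divides [h] locally and, being
    regular, cancels once at each step. *)
Lemma divide_out k n g h : y ^+ k * g = x ^+ n * h ->
  exists w d, e2 w = 1 /\ w * g = x ^+ n * d.
Proof.
elim: k g h => [|k IH] g h.
  by rewrite expr0 mul1r => ->; exists 1, h; rewrite rmorph1 mul1r.
move=> gh; have /y_div[w [d [w1 wd]]] : e2 h = 0.
  have := congr1 e2 gh; rewrite !rmorphM !rmorphXn /= e2y expr0n mul0r.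
  by move=> /esym/eqP; rewrite mulf_eq0 expf_eq0 (negbTE e2x) andbF => /eqP.
have /IH[v [d' [v1 vd]]] : y ^+ k * (w * g) = x ^+ n * d.
  apply: y_reg; rewrite mulrA -exprS mulrCA gh [RHS]mulrCA -wd; ring.
by exists (v * w), d'; rewrite rmorphM v1 w1 mulr1 -mulrA.
Qed.

(** The lines [e1] and [e2] meet at [p]. If [c] is locally [y ^+ k * d], cancelling [y ^+ k] shows
    that [e2 d] is divisible by every power of [p], hence zero, so another factor [y] comes out. *)
Lemma vanishes_propagate c : vanishes e1 x c -> vanishes e2 y c.
Proof.
move=> xc; elim=> [|k [w [d [w1 wd]]]].
  by exists 1, c; rewrite rmorph1 expr0.
have /y_div[v [d' [v1 vd]]] : e2 d = 0.
  apply: dvdz_expn_eq0 => n; have [u [h [u1 uh]]] := xc n.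
  have /divide_out[v [d' [v1 vd]]] : y ^+ k * (u * d) = x ^+ n * (w * h).
    by rewrite mulrCA -wd mulrCA uh mulrCA.
  have := congr1 e2 vd; rewrite !rmorphM /= v1 mul1r rmorphXn => ud.
  (* [u] has value 1 on the first line, hence a value congruent to 1 mod [p] on the second. *)
  have up : coprimez (p ^+ n) (e2 u).
    apply: coprimezXl; have /dvdzP[z uz] := e12 u.
    by apply/coprimezP; exists (z, 1); rewrite /= -uz u1; ring.
  rewrite -(Gauss_dvdzr _ up) ud dvdz_mulr //.
  exact: dvdz_exp2r.
exists (v * w), d'; rewrite rmorphM v1 w1 mulr1 -mulrA wd; split=> //.
by rewrite mulrCA vd exprSr mulrA.
Qed.

End Propagation.

Lemma nodes_factor (p : base) : p \in nodes -> exists q, p = eqn1 * eqn2 * q.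
Proof.
move=> /andP[p0 p6].
have /factor_theorem[q pq] : root (p : {poly int}) 0 by [].
have /factor_theorem[r qr] : root q 6.
  by move: p6; rewrite pq !hornerE mulf_eq0 orbF.
by exists r; rewrite pq qr subr0 mulrC [r * _]mulrC mulrA.
Qed.

Lemma ext_nodes_factor (B : comPzRingType) (f : {rmorphism base -> B}) b :
  b \in ext_ideal f nodes -> exists d, b = f eqn1 * f eqn2 * d.
Proof.
move=> /asboolP[s [sI ->]]; elim: s sI => [_|[c p] s IH /= /andP[pI /IH[d dE]]].
  by exists 0; rewrite big_nil mulr0.
have [q ->] := nodes_factor pI; exists (c * f q + d).
by rewrite big_cons dE /= !rmorphM mulrDr mulrCA.
Qed.

(** Supplies a start outside a finite set of exceptions, from which [N] shifts lead to index 0. *)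
Lemma avoid_neg (T : seq int) : exists N : nat, - N%:Z \notin T.
Proof.
have absT t : t \in T -> (`|t| <= \sum_(t <- T) `|t|)%N.
  by move=> tT; rewrite (big_rem t) //= leq_addr.
exists (\sum_(t <- T) `|t|%N).+1; apply/negP => /absT.
by rewrite abszN absz_nat ltnn.
Qed.

(** * Lines in the tensor square of a lift *)

Section NoLift.
Variables (B : comPzRingType) (f : {rmorphism base -> B}) (rho : {rmorphism B -> chain}).
Hypotheses (f_we : weakly_etale f) (rho_surj : forall h, exists b, rho b = h).
Hypothesis rho_base : forall p, rho (f p) = const_chain p.
Hypothesis rho_ker : forall b, rho b = 0 -> exists d, b = f eqn1 * f eqn2 * d.

Definition lift1 (s : option int) : {rmorphism B -> int} := line1 s \o rho.
Definition lift2 (s : option int) : {rmorphism B -> int} := line2 s \o rho.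

(** Local division in [chain] holds in [B] up to a multiple of [f eqn1 * f eqn2], which is itself
    divisible by [f eqn1]. *)
Lemma lift1_div s : local_div (lift1 s) (f eqn1).
Proof.
move=> b /chain_local_div1[h [z [h1 hz]]].
have [w wh] := rho_surj h; have [y yz] := rho_surj z.
have /rho_ker[d dE] : rho (w * b - f eqn1 * y) = 0.
  by rewrite rmorphB !rmorphM /= rho_base wh yz hz subrr.
exists w, (y + f eqn2 * d); split; first by rewrite /lift1 /= wh.
by rewrite mulrDr [f eqn1 * (_ * _)]mulrA -dE addrC subrK.
Qed.

Lemma lift2_div s : local_div (lift2 s) (f eqn2).
Proof.
move=> b /chain_local_div2[h [z [h1 hz]]].
have [w wh] := rho_surj h; have [y yz] := rho_surj z.
have /rho_ker[d dE] : rho (w * b - f eqn2 * y) = 0.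
  by rewrite rmorphB !rmorphM /= rho_base wh yz hz subrr.
exists w, (y + f eqn1 * d); split; first by rewrite /lift2 /= wh.
by rewrite mulrDr mulrCA mulrA -dE addrC subrK.
Qed.

Lemma lift1_base s p : lift1 s (f p) = (p : {poly int}).[0].
Proof. by rewrite /lift1 /= rho_base. Qed.

Lemma lift2_base s p : lift2 s (f p) = (p : {poly int}).[6].
Proof. by rewrite /lift2 /= rho_base. Qed.

Lemma lift1_compat s p : lift1 s (f p) = lift1 None (f p).
Proof. by rewrite !lift1_base. Qed.

Lemma lift2_compat s p : lift2 s (f p) = lift2 None (f p).
Proof. by rewrite !lift2_base. Qed.

(** Restriction to the line [(s, oo)] over [X = 0]; [ev2] is the analogue over [X = 6]. *)
Definition ev1 s := tensor_pair (lift1_compat s).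
Definition ev2 s := tensor_pair (lift2_compat s).

Local Notation C := (tensor_alg f f).
Local Notation X := (tensor_inl f (f eqn1)).
Local Notation Y := (tensor_inl f (f eqn2)).

Lemma ev1_inl s p : ev1 s (tensor_inl f (f p)) = (p : {poly int}).[0].
Proof. by rewrite [LHS]tensor_pair_pure rmorph1 mulr1 lift1_base. Qed.

Lemma ev2_inl s p : ev2 s (tensor_inl f (f p)) = (p : {poly int}).[6].
Proof. by rewrite [LHS]tensor_pair_pure rmorph1 mulr1 lift2_base. Qed.

Lemma ev12 s c : (2 %| ev1 s c - ev2 s c)%Z.
Proof.
elim/tensor_ind: c => [|x y Hx Hy|b b']; first by rewrite !rmorph0.
  by rewrite !rmorphB /= opprD addrACA -opprD rpredB.
rewrite !tensor_pair_pure; apply: dvdz_subM; rewrite /lift1 /lift2 /=.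
  by have [] := chainP (rho b).
by have [] := chainP (rho b').
Qed.

(** The second index does not move because [shift] fixes the limit point. *)
Lemma ev12_shift s c : (3 %| ev1 s c - ev2 (shift s) c)%Z.
Proof.
elim/tensor_ind: c => [|x y Hx Hy|b b']; first by rewrite !rmorph0.
  by rewrite !rmorphB /= opprD addrACA -opprD rpredB.
rewrite !tensor_pair_pure; apply: dvdz_subM; rewrite /lift1 /lift2 /=.
  by have [_ /(_ s)] := chainP (rho b).
by have [_ /(_ None)] := chainP (rho b').
Qed.

(** Cross to the line [X = 6] with index [shift s] through the node at 3, then back to [X = 0]
    through the node at 2. *)
Lemma vanishes_shift s c : vanishes (ev1 s) X c -> vanishes (ev1 (shift s)) X c.
Proof.
have [fflat _] := f_we.
move=> /(@vanishes_propagate _ X Y (ev1 s) (ev2 (shift s)) 3) H.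
have {H} : vanishes (ev2 (shift s)) Y c.
  apply: H => //; first exact: ev12_shift.
  - by rewrite ev2_inl hornerX.
  - by rewrite ev2_inl hornerX.
  - by rewrite ev2_inl hornerXsubC subrr.
  - by apply: tensor_inl_regular => //; apply: mulfI; exact: negbT (polyXsubC_eq0 _).
  - apply: tensor_local_div; [|exact: lift2_div|exact: lift2_div].
    by rewrite lift2_base hornerXsubC subrr.
move=> /(@vanishes_propagate _ Y X (ev2 (shift s)) (ev1 (shift s)) 2); apply => //.
- by move=> z; rewrite -opprB rpredN ev12.
- by rewrite ev1_inl hornerXsubC.
- by rewrite ev1_inl hornerXsubC.
- by rewrite ev1_inl hornerX.
- apply: tensor_inl_regular => //; apply: mulfI; exact: negbT (polyX_eq0 _).
- apply: tensor_local_div; [|exact: lift1_div|exact: lift1_div].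
  by rewrite lift1_base hornerX.
Qed.

Lemma ev1_diag c : ev1 None c = lift1 None (mult_map f c).
Proof.
elim/tensor_ind: c => [|x y Hx Hy|b b']; first by rewrite !rmorph0.
  by rewrite !rmorphB /= Hx Hy.
by rewrite tensor_pair_pure mult_map_pure rmorphM.
Qed.

Lemma ev1_eventually c : eventually_const (fun s => ev1 s c).
Proof.
elim/tensor_ind: c => [|x y [T HT] [U HU]|b b'].
- by exists [::] => n _; rewrite !rmorph0.
- exists (T ++ U) => n; rewrite mem_cat negb_or => /andP[/HT xn /HU yn].
  by rewrite !rmorphB /= xn yn.
have [_ _ [T HT]] := chainP (rho b); exists T => n /HT[bn _].
by rewrite !tensor_pair_pure /lift1 /= bn.
Qed.

Lemma no_lift : False.
Proof.
(* The indicator separates index 0, with value 3, from the limit point, with value 0. *)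
have [b bE] := rho_surj (indicator3 0).
pose c := tensor_inl f b - tensor_inr f b.
have c_ker : mult_map f c = 0.
  by rewrite rmorphB /= !mult_map_pure mulr1 mul1r subrr.
have [u [u1 uc]] := pure_ker_of_flat (mult_map_surj f) f_we.2 c_ker.
have [T uT] := ev1_eventually u; have [N NT] := avoid_neg T.
(* At [-N] the element [u] takes its value at the limit, which is its diagonal value 1, and
   [u c = 0]; each shift then moves one index up. *)
have van k : vanishes (ev1 (Some (k%:Z - N%:Z))) X c.
  elim: k => [n|k IH]; last by have := vanishes_shift IH; rewrite /= addrAC -PoszD addn1.
  exists u, 0; split; last by rewrite uc mulr0.
  by rewrite sub0r uT // ev1_diag u1 rmorph1.
(* At index 0, vanishing to order one already gives 3 = 0. *)
have := van N 1%N; rewrite subrr => -[w [d [w1 wc]]].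
have := congr1 (ev1 (Some 0)) wc; rewrite expr1 !rmorphM /= w1 mul1r ev1_inl hornerX mul0r.
rewrite rmorphB /= !tensor_pair_pure !rmorph1 mul1r mulr1 /lift1 /= bE.
by rewrite !line1_indicator3.
Qed.

End NoLift.

Theorem corollary17 :
  exists (A : comPzRingType) (I : idealType A) (Bbar : comPzRingType)
         (g : {rmorphism quot_ring I -> Bbar}),
    weakly_etale g /\
    ~ exists (B : comPzRingType) (f : {rmorphism A -> B}),
        weakly_etale f /\ alg_iso (quot_map f I) g.
Proof.
exists base, nodes, chain, chain_map; split; first exact: chain_map_weakly_etale.
case=> B [f [f_we [phi [phi_bij phiE]]]].
(* The map [rho] is reduction modulo the extended ideal followed by the isomorphism with [chain]. *)
apply: (@no_lift B f (phi \o quot_pi (ext_ideal f nodes))) => //.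
- move=> h; have [psi _ psiK] := phi_bij; have [b bE] := quot_pi_surj (psi h).
  by exists b; rewrite /= -bE psiK.
- by move=> p; rewrite /= -quot_mapE phiE chain_map_pi.
- move=> b phib; apply: ext_nodes_factor.
  have /quot_pi_eq : quot_pi (ext_ideal f nodes) b = quot_pi _ 0.
    by apply: (bij_inj phi_bij); rewrite !rmorph0.
  by rewrite subr0.
Qed.
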